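(* Let $P$ and $Q$ be coprime polynomials with integer coefficients, where $P$ has degree $d_0$ and $Q$ is monic of degree $d-1 > 0$, and let $a$ be an integer. Put $R = \max_{Q(\theta)=0}|\theta|$ and $A(t) = (t-a)Q(t) + P(t)$. Suppose that \[ d \geq \hat{d} = 2.13 d_0 + 23, \qquad |a| \geq L(P)\max\{2, (R+1)^{d_0}\} + 2R + 2, \] and let $\eta > 0$. Define \[ f(u) = (3 - 2\sqrt{2})\frac{u - d_0 - 1}{u + \sqrt{2} - 1}, \quad \hat{\kappa} = 10\left(1 + \frac{1}{11 f(d) - 1}\right), \quad \kappa = \hat{\kappa} + \eta, \] \[ a_0 = \left(2^{2d}(R+1)^d L(P)^2\right)^{\frac{\kappa}{\eta(11 f(\hat{d}) - 1)}} + 1, \] \[ C = 2^{42(d_0+\eta+1)d^2}(R+1)^{5(d_0+\eta+1)d^2}|a|^{14(d_0+\eta+1)d^2}. \] Then there is a unique real zero $\xi$ of $A$ with $|\xi - a| < 1$, we have \[ \hat{\kappa} \leq 10\left(1 + \frac{1}{11 f(\hat{d}) - 1}\right) < \hat{d}, \] and if $|a| \geq a_0$, then $\xi$ is of effective strict type at most $\kappa$; more precisely, \[ \left|\xi - \frac{p}{q}\right| \geq \frac{1}{C q^{\kappa}} \] for all integers $p$ and $q \geq 1$.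
   Context: For a polynomial $P$, the length $L(P)$ is the sum of the absolute values of its coefficients. A real algebraic number $\xi$ is said to have effective strict type at most $\kappa$ if there is an explicit constant $C$ with $|\xi - p/q| \geq 1/(Cq^\kappa)$ for all integers $p$ and $q\ge 1$. *)

(* Defs.v *)
From HB Require Import structures.
From mathcomp Require Import all_boot all_order all_algebra.
From mathcomp Require Import all_classical all_reals all_analysis.
From mathcomp Require Export complex.
Set Implicit Arguments.
Unset Strict Implicit.
Unset Printing Implicit Defensive.
Import Order.TTheory GRing.Theory Num.Theory.

Local Open Scope classical_set_scope.
Local Open Scope ring_scope.

Definition poly_length (P : {poly int}) : int := \sum_(i < size P) `|P`_i|.

(* The supremum of a set of moduli that is finite, and nonempty as soon as
   Q has positive degree, hence the maximum: see [max_root_modulusP]. *)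
Definition max_root_modulus (R : realType) (Q : {poly int}) : R :=
  sup [set ComplexField.Normc.normc z | z in
         [set z : R[i] | root (map_poly intr Q) z]].

(* "Effective" is not a property of the pair (xi, kappa): it asks that a value
   of the constant C be exhibited. *)
Definition strict_type_le (R : realType) (xi kappa : R) : Prop :=
  algebraicOver (@ratr R) xi /\
  exists2 C : R, 0 < C &
    forall p q : int, 1 <= q ->
      1 / (C * q%:~R `^ kappa) <= `|xi - p%:~R / q%:~R|.

Lemma max_root_modulusP (R : realType) (Q : {poly int}) : (1 < size Q)%N ->
  (exists2 z : R[i], root (map_poly intr Q) z &
     ComplexField.Normc.normc z = max_root_modulus R Q) /\
  (forall z : R[i], root (map_poly intr Q) z ->
     ComplexField.Normc.normc z <= max_root_modulus R Q).
Proof.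
move=> sQ; set p : {poly R[i]} := map_poly intr Q.
have sp : size p = size Q.
  by rewrite size_map_inj_poly //; exact: intr_inj.
have p0 : p != 0 by rewrite -size_poly_gt0 sp; apply: leq_trans sQ.
have [r Dp] := closed_field_poly_normal p.
have rP z : root p z = (z \in r).
  by rewrite Dp rootZ ?lead_coef_eq0 // root_prod_XsubC.
pose m := fun z : R[i] => ComplexField.Normc.normc z.
have [z0 z0r zmax] : exists2 z0, z0 \in r & forall z, z \in r -> m z <= m z0.
  have : (0 < size r)%N.
    move: sp; rewrite Dp size_scale ?lead_coef_eq0 // size_prod_XsubC.
    by case: (size r) => // e; rewrite -e in sQ.
  elim: (r) => // x s IH _; case: (posnP (size s)) => [/size0nil -> | /IH [y ys ymax]].
    by exists x => [|z]; rewrite inE // => /eqP ->.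
  have [xy|yx] := leP (m x) (m y).
    exists y => [|z]; rewrite inE ?ys ?orbT // => /orP[/eqP -> //|]; exact: ymax.
  exists x => [|z]; rewrite inE ?eqxx // => /orP[/eqP -> //|/ymax zy].
  exact: le_trans zy (ltW yx).
have ub : ubound [set m z | z in [set z : R[i] | root p z]] (m z0).
  by move=> _ [z /= rz <-]; apply: zmax; rewrite -rP.
have in0 : [set m z | z in [set z : R[i] | root p z]] (m z0).
  by exists z0 => //=; rewrite rP.
have -> : max_root_modulus R Q = m z0.
  apply/eqP; rewrite eq_le; apply/andP; split.
    by apply: ge_sup => //; exists (m z0).
  by apply: ub_le_sup => //; exists (m z0).
by split=> [|z]; [exists z0; rewrite ?rP | rewrite -/p rP; exact: zmax].
Qed.

(* Main.v *)
(* Thue's method with a polynomial of degree 10 in the second variable. Since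
   (xi - a) Q(xi) = - P(xi), the integer a is an exceptionally good approximation
   to xi, with |xi - a| about |a|^(d0 + 1 - d). The roots of A other than xi stay
   close to those of Q; if B divides A and B(xi) <> 0, the product of the values of
   Q at the roots of B is an integer of modulus < 1, so B is constant, and A is
   irreducible.

   By pigeonhole there is G(x, y) with small integer coefficients, of degree < M in
   x and 10 in y, such that d^i G / dx^i vanishes at (xi, xi) for i < T, where
   11 M is close to (d + sqrt 2 - 1) T. Wronskians give some i, at most about
   11 M - d T, such that d^i G / dx^i does not vanish at (a, p/q); its value there
   is thus at least q^(-10), up to a factor i!, while Taylor expansion at (xi, xi)
   bounds it in terms of |xi - a|^(T - i) and |xi - p/q|. Choosing T so that the
   first term is negligible bounds |xi - p/q| from below. *)
Require Import Defs.
From HB Require Import structures.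
From mathcomp Require Import all_boot all_order all_algebra.
From mathcomp Require Import perm zify ring lra.
From mathcomp Require Import all_classical all_reals all_analysis.
Set Implicit Arguments.
Unset Strict Implicit.
Unset Printing Implicit Defensive.
Import Order.TTheory GRing.Theory Num.Theory.
Import ComplexField.Normc.

Local Open Scope ring_scope.

(** * Products of polynomial values over the roots of a monic polynomial *)

(** Write [11 M = (d + s) T]. The [d T] conditions leave [s T] free unknowns, so [G] has height
    about [|a|^(M / s)]: among the [d] conjugates only xi is as large as [a], the others stay below
    [R + 1]. Evaluation costs another [|a|^M], while a derivative of order about [s T] still keeps
    [(1 - s) T] powers of [|xi - a|]. The ratio of gain to cost is thus [11 (d - 1 - d0) / (d + s)]
    times [s (1 - s) / (1 + s)]. The last factor is largest at [s = sqrt 2 - 1], with value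
    [3 - 2 sqrt 2], and the ratio becomes [11 f(d)]. Taking [T] just large enough for the net gain
    to beat [q^10] adds [10 / (11 f(d) - 1)] to the exponent 10; terms of lower order are absorbed
    by [eta] once [|a| >= a0]. With degree [n] in [y] the exponent would be
    [n (1 + 1 / ((n + 1) f - 1))], which for [f] near [3 - 2 sqrt 2] is least at [n = 10]. *)

Lemma prodr_const_seq (A : pzSemiRingType) (T : Type) (s : seq T) (c : A) :
  \prod_(x <- s) c = c ^+ size s.
Proof. by elim: s => [|x s IHs]; rewrite ?big_nil // big_cons IHs -exprS. Qed.

(** Splitting [v] into linear factors reduces this to [\det (M - z)], up to sign the characteristic
    polynomial at [z]; the signs turn [z - g] into [g - z]. *)
Lemma det_horner_mx (C : closedFieldType) (n : nat) (M : 'M[C]_n.+1)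
    (v : {poly C}) (s : seq C) :
  char_poly M = \prod_(g <- s) ('X - g%:P) ->
  \det (horner_mx M v) = \prod_(g <- s) v.[g].
Proof.
move=> charM.
have ss : size s = n.+1.
  by have := size_char_poly M; rewrite charM size_prod_XsubC => -[].
have [r vr] := closed_field_poly_normal v; rewrite {1}vr.
rewrite linearZ /= detZ (rmorph_prod (horner_mx M)) /=.
have -> : \prod_(g <- s) v.[g] =
    lead_coef v ^+ n.+1 * \prod_(g <- s) \prod_(z <- r) (g - z).
  rewrite -ss -prodr_const_seq -big_split; apply: eq_bigr => g _ /=.
  rewrite {1}vr hornerZ horner_prod; congr (_ * _).
  by apply: eq_bigr => z _; rewrite hornerXsubC.
congr (_ * _).
rewrite (big_morph (fun X : 'M[C]_n.+1 => \det X) (@det_mulmx _ _) (det1 _ _)).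
rewrite exchange_big /=; apply: eq_bigr => z _.
rewrite rmorphB /= horner_mx_X horner_mx_C.
have -> : M - z%:M = (-1) *: (z%:M - M) by rewrite scaleN1r opprB.
rewrite detZ; have -> : \det (z%:M - M) = (char_poly M).[z].
  rewrite /char_poly -[RHS]/(horner_eval z _).
  rewrite -det_map_mx; congr (\det _); apply/matrixP=> i j.
  by rewrite !mxE /= horner_evalE hornerD hornerMn hornerX hornerN hornerC.
rewrite charM horner_prod -{1}ss -prodr_const_seq -big_split /=.
by apply: eq_bigr => g _; rewrite hornerXsubC mulN1r opprB.
Qed.

(** The product is the resultant of [G] and [v], obtained as the determinant of [v] at the companion
    matrix of [G]: its integrality comes from the integer entries of that matrix. Degree 0 is
    treated apart, the previous lemma being stated in positive dimension. *)
Lemma prod_horner_roots_int (C : closedFieldType) (G v : {poly int})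
    (s : seq C) :
  G \is monic -> map_poly intr G = \prod_(g <- s) ('X - g%:P) ->
  exists N : int, \prod_(g <- s) (map_poly intr v).[g] = N%:~R.
Proof.
move=> monG Gs.
have := companionmxK monG; set Co := companionmx G; move: Co.
case: (size G).-1 => [|n] Co CoE.
  exists 1.
  have : size (\prod_(g <- s) ('X - g%:P)) = 1%N.
    by rewrite -Gs -CoE map_char_poly size_char_poly.
  by rewrite size_prod_XsubC => -[/size0nil ->]; rewrite big_nil.
exists (\det (horner_mx Co v)).
rewrite -det_map_mx map_horner_mx; symmetry.
by apply: det_horner_mx; rewrite -map_char_poly CoE.
Qed.

(** * Wronskians and orders of vanishing *)

(* In the Wronskian the Euler operator [X d/dX] replaces [d/dX]: it preserves degrees,
   so the leading coefficients of the entries form a Vandermonde matrix. *)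
Definition theta (F : nzRingType) (p : {poly F}) : {poly F} := 'X * p^`().

Lemma coef_iter_theta (F : comNzRingType) (i k : nat) (p : {poly F}) :
  (iter i (@theta F) p)`_k = p`_k * k%:R ^+ i.
Proof.
elim: i => [|i IHi] /=; first by rewrite expr0 mulr1.
rewrite /theta coefXM; case: k IHi => [|k] IHi; last first.
  by rewrite /= coef_deriv IHi exprSr mulrA mulr_natr.
by rewrite /= expr0n /= mulr0.
Qed.

Lemma size_iter_theta (F : comNzRingType) (i : nat) (p : {poly F}) :
  (size (iter i (@theta F) p) <= size p)%N.
Proof.
by apply/leq_sizeP => k pk; rewrite coef_iter_theta nth_default // mul0r.
Qed.

Lemma iter_theta_lin (F : comNzRingType) (i n : nat) (e : nat -> F)
    (w : nat -> {poly F}) :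
  iter i (@theta F) (\sum_(h < n) e h *: w h) =
  \sum_(h < n) e h *: iter i (@theta F) (w h).
Proof.
apply/polyP=> k; rewrite coef_iter_theta !coef_sum mulr_suml.
by apply: eq_bigr => h _; rewrite !coefZ coef_iter_theta -mulrA.
Qed.

Lemma dvdp_iter_theta (F : fieldType) (c : F) (o i : nat) (p : {poly F}) :
  ('X - c%:P) ^+ o %| p -> ('X - c%:P) ^+ (o - i) %| iter i (@theta F) p.
Proof.
move=> op; elim: i => [|i IHi] /=; first by rewrite subn0.
rewrite subnS; case: (o - i)%N IHi => [|n] IHi; first by rewrite dvd1p.
have /dvdpP[q ->] := IHi.
rewrite /theta derivM deriv_exp; apply: dvdp_mull.
rewrite exprS mulrA; apply: dvdp_add.
  exact: dvdp_mull.
by rewrite derivB derivX derivC subr0 mul1r /= mulrnAr -mulrnAl dvdp_mull.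
Qed.

(** Gaussian elimination on degrees: an element of largest degree is kept, multiples of it are
    subtracted from the others to lower their degree, and induction treats the rest. As [s] may be
    dependent, [ws] can be shorter; distinct degrees stand in for independence. *)
Lemma echelon_degrees (F : fieldType) (s : seq {poly F}) :
  exists ws : seq {poly F},
    [/\ (size ws <= size s)%N, uniq [seq size w | w : {poly F} <- ws], 0 \notin ws,
        forall w : {poly F}, w \in ws -> exists2 u : {poly F}, u \in s & (size w <= size u)%N &
        forall u : {poly F}, u \in s ->
          exists e : nat -> F, u = \sum_(h < size ws) e h *: ws`_h].
Proof.
have [n] := ubnP (size s); elim: n s => // n IHn s /ltnSE sn.
have [/allP s0|/allPn[p0 p0s p0n]] := boolP (all (pred1 0) s).
  exists [::]; split=> // u us; exists (fun=> 0).
  by rewrite big_ord0; apply/eqP/s0.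
have [p ps pmax] : exists2 p : {poly F}, p \in s &
    forall u : {poly F}, u \in s -> (size u <= size p)%N.
  elim: s p0 p0s {IHn sn p0n} => // x s IHs _ _.
  have [/size0nil ->|] := posnP (size s).
    by exists x => [|u]; rewrite inE // => /eqP->.
  case: s IHs => // y s IHs _; have [p ps pmax] := IHs _ (mem_head _ _).
  have [le_px|lt_xp] := leqP (size p) (size x).
    exists x => [|u]; first exact: mem_head.
    by rewrite inE => /orP[/eqP->//|/pmax/leq_trans]; apply.
  exists p => [|u]; first by rewrite inE ps orbT.
  by rewrite inE => /orP[/eqP->|/pmax//]; apply: ltnW.
have pn0 : p != 0.
  by rewrite -size_poly_gt0 (leq_trans _ (pmax _ p0s)) // size_poly_gt0.
pose k (u : {poly F}) := u`_(size p).-1 / lead_coef p.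
pose s' := [seq u - k u *: p | u : {poly F} <- rem p s].
have s's (u : {poly F}) : u \in s -> (size (u - k u *: p)%R < size p)%N.
  move=> us; rewrite [ltnRHS]polySpred // ltnS; apply/leq_sizeP => j.
  rewrite leq_eqVlt => /orP[/eqP<-|pj].
    by rewrite coefB coefZ /k -/(lead_coef p) divfK ?lead_coef_eq0 // subrr.
  rewrite nth_default // (leq_trans (size_polyD _ _)) // size_polyN geq_max.
  move: pj; rewrite -polySpred // => pj.
  rewrite (leq_trans (pmax _ us)) //= (leq_trans (size_scale_leq _ _)) //.
have szs' : (size s').+1 = size s.
  by rewrite size_map size_rem //; case: (s) ps.
have [|ws [szw uw w0 wle wspan]] := IHn s'; first by rewrite szs'.
have wlt (w : {poly F}) : w \in ws -> (size w < size p)%N.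
  by move=> /wle[_ /mapP[u /mem_rem us ->] /leq_ltn_trans]; apply; apply: s's.
exists (p :: ws); split=> /=.
- by rewrite -szs' ltnS.
- rewrite uw andbT; apply/mapP => -[w /wlt lt_wp e].
  by rewrite e ltnn in lt_wp.
- by rewrite inE negb_or eq_sym pn0.
- move=> w; rewrite inE => /orP[/eqP->|/wlt/ltnW]; first by exists p.
  by exists p.
move=> u us; have [->|un] := eqVneq u p.
  exists (fun h => (h == 0%N)%:R); rewrite big_ord_recl /= scale1r big1 ?addr0 //.
  by move=> i _; rewrite scale0r.
have u's : u - k u *: p \in s'.
  apply/mapP; exists u => //; move: us; rewrite (perm_mem (perm_to_rem ps)) inE.
  by rewrite (negPf un).
have [e ue] := wspan _ u's.
exists (fun h => if h is h'.+1 then e h' else k u).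
by rewrite big_ord_recl /= -ue addrC subrK.
Qed.

Lemma size_coef_prod (F : comNzRingType) (I : Type) (r : seq I)
    (f : I -> {poly F}) (m : I -> nat) :
  (forall i, (size (f i) <= (m i).+1)%N) ->
  (size (\prod_(i <- r) f i)%R <= (\sum_(i <- r) m i).+1)%N /\
  (\prod_(i <- r) f i)`_(\sum_(i <- r) m i) = \prod_(i <- r) (f i)`_(m i).
Proof.
move=> fm; elim: r => [|i r [IHs IHc]]; first by rewrite !big_nil size_poly1 coef1.
rewrite !big_cons; split.
  apply: leq_trans (size_polyMleq _ _) _.
  have := fm i; move: IHs; lia.
have lt_mi : (m i < (m i + \sum_(j <- r) m j).+1)%N by rewrite ltnS leq_addr.
rewrite -IHc coefM (bigD1 (Ordinal lt_mi)) //=.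
rewrite addKn [X in _ + X]big1 ?addr0 // => j jm.
have [lt_jm|le_mj] := ltnP j (m i).
  rewrite [X in _ * X]nth_default ?mulr0 //.
  by apply: leq_trans IHs _; lia.
rewrite nth_default ?mul0r //; apply: leq_trans (fm i) _.
rewrite ltn_neqAle le_mj andbT; apply: contra jm => /eqP e.
by apply/eqP/val_inj.
Qed.

Definition theta_wronskian (F : comNzRingType) (ws : seq {poly F}) :
    'M[{poly F}]_(size ws) :=
  \matrix_(i, h) iter i (@theta F) ws`_h.

Lemma theta_wronskian_neq0 (F : numFieldType) (m : nat) (ws : seq {poly F}) :
  uniq [seq size w | w : {poly F} <- ws] -> 0 \notin ws ->
  (forall w : {poly F}, w \in ws -> (size w <= m.+1)%N) ->
  \det (theta_wronskian ws) != 0 /\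
  (size (\det (theta_wronskian ws)) <= (size ws * m).+1)%N.
Proof.
move=> uw w0 wm; set r := size ws; set W := theta_wronskian ws.
pose n (h : 'I_r) := (size ws`_h).-1.
have wn (h : 'I_r) : size ws`_h = (n h).+1.
  rewrite polySpred //; apply: contra w0 => /eqP <-; exact: mem_nth.
(* As [theta] does not raise degrees, the degree of an entry is bounded by its column alone, and
   every permutation contributes to the same top degree. *)
have term (s : 'S_r) :
    (size (\prod_i W i (s i))%R <= (\sum_h n h).+1)%N /\
    (\prod_i W i (s i))`_(\sum_h n h) = \prod_i (W i (s i))`_(n (s i)).
  rewrite [(\sum_h n h)%N](reindex_perm s) /=.
  apply: (@size_coef_prod _ _ _ (fun i => W i (s i)) (fun i => n (s i))) => i.
  by rewrite mxE -wn size_iter_theta.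
have sn : (\sum_h n h <= r * m)%N.
  rewrite -[X in (_ <= X * _)%N]card_ord -sum_nat_const; apply: leq_sum => h _.
  by rewrite -ltnS -wn wm // mem_nth.
split; last first.
  rewrite /determinant; apply: leq_trans (size_sum _ _ _) _.
  apply/bigmax_leqP => s _.
  apply: leq_trans (_ : (\sum_h n h).+1 <= _)%N; last by rewrite ltnS.
  apply: leq_trans (proj1 (term s)).
  by case: (odd_perm s); rewrite ?expr0 ?expr1 ?mul1r ?mulN1r ?size_polyN.
have : (\det W)`_(\sum_h n h) != 0.
  have -> : (\det W)`_(\sum_h n h) = \det (\matrix_(i, h) (W i h)`_(n h)).
    rewrite coef_sum; apply: eq_bigr => s _.
    have -> : (-1) ^+ odd_perm s = ((-1) ^+ odd_perm s)%:P :> {poly F}.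
      by rewrite rmorph_sign.
    rewrite coefCM (proj2 (term s)); congr (_ * _).
    by apply: eq_bigr => i _; rewrite [RHS]mxE.
  pose V := Vandermonde r (\row_(h < r) (n h)%:R : 'rV[F]_r).
  have -> : \matrix_(i, h) (W i h)`_(n h) =
      V *m diag_mx (\row_(h < r) lead_coef ws`_h).
    apply/matrixP=> i h; rewrite mul_mx_diag !mxE coef_iter_theta mulrC.
    by congr (_ * _); rewrite lead_coefE wn.
  rewrite det_mulmx det_diag mulf_neq0 //; last first.
    apply/prodf_neq0 => h _; rewrite mxE lead_coef_eq0 -size_poly_gt0.
    by rewrite wn.
  rewrite det_Vandermonde; apply/prodf_neq0 => i _.
  apply/prodf_neq0 => j lt_ij; rewrite !mxE subr_eq0 eqr_nat.
  apply: contraTN lt_ij => /eqP e.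
  have /eqP : size ws`_i = size ws`_j by rewrite !wn e.
  rewrite -!(nth_map _ 0%N (fun w : {poly F} => size w)) // nth_uniq ?size_map //.
  by move=> /eqP ->; rewrite ltnn.
by apply: contraNneq => ->; rewrite coef0.
Qed.

(** Cramer's rule: the Wronskian applied to the vector [e] gives the iterates of [theta] on [u], the
    [i]-th divisible by [('X - c)^(o - i)]; multiplying by the adjugate leaves the determinant times
    a coefficient [e h], taken nonzero. *)
Lemma dvdp_theta_wronskian (F : numFieldType) (ws : seq {poly F})
    (u : {poly F}) (e : nat -> F) (c : F) (o : nat) :
  u != 0 -> u = \sum_(h < size ws) e h *: ws`_h -> ('X - c%:P) ^+ o %| u ->
  ('X - c%:P) ^+ (o - (size ws).-1) %| \det (theta_wronskian ws).
Proof.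
move=> u0 ue ou.
have [h eh] : exists h : 'I_(size ws), e h != 0.
  apply/existsP; apply: contraNT u0 => /existsPn e0.
  by rewrite ue big1 // => h _; have /negPn/eqP-> := e0 h; rewrite scale0r.
pose v := \col_(j < size ws) (e j)%:P : 'cV[{poly F}]_(size ws).
have Wv (i : 'I_(size ws)) : (theta_wronskian ws *m v) i 0 = iter i (@theta F) u.
  rewrite ue iter_theta_lin !mxE; apply: eq_bigr => k _.
  by rewrite !mxE mulrC mul_polyC.
have : ('X - c%:P) ^+ (o - (size ws).-1) %| \det (theta_wronskian ws) * (e h)%:P.
  have -> : \det (theta_wronskian ws) * (e h)%:P =
      (\adj (theta_wronskian ws) *m (theta_wronskian ws *m v)) h 0.
    by rewrite mulmxA mul_adj_mx mul_scalar_mx !mxE.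
  rewrite mxE; apply: (big_ind (dvdp _)) => [||i _]; first exact: dvdp0.
    by move=> *; apply: dvdp_add.
  apply: dvdp_mull; rewrite Wv.
  apply: dvdp_trans (dvdp_iter_theta i ou).
  apply: dvdp_exp2l; apply: leq_sub2l.
  by rewrite -ltnS prednK // (leq_ltn_trans _ (ltn_ord i)).
by rewrite mulrC mul_polyC dvdpZr.
Qed.

(** A zero estimate in which each point has its own combination [u c]. All share one Wronskian,
    which vanishes at [c] to the order of [u c] there, less [(size s).-1]; its degree bounds the
    sum. *)
Lemma sum_vanishing_orders_le (F : numFieldType) (m : nat) (s : seq {poly F})
    (pts : seq F) (u : F -> {poly F}) (o : F -> nat) :
  (forall p : {poly F}, p \in s -> (size p <= m.+1)%N) -> uniq pts ->
  (forall c, c \in pts -> [/\ u c != 0, ('X - c%:P) ^+ o c %| u c &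
     exists e : nat -> F, u c = \sum_(j < size s) e j *: s`_j]) ->
  (\sum_(c <- pts) (o c - (size s).-1) <= size s * m)%N.
Proof.
move=> sm upts pts_u.
have [ws [szw uw w0 wle wspan]] := echelon_degrees s.
have wm (w : {poly F}) : w \in ws -> (size w <= m.+1)%N.
  by move=> /wle[p ps /leq_trans]; apply; apply: sm.
have [W0 szW] := theta_wronskian_neq0 uw w0 wm.
pose q c := ('X - c%:P) ^+ (o c - (size s).-1).
have qW c : c \in pts -> q c %| \det (theta_wronskian ws).
  move=> /pts_u[u0 ou [e ue]].
  have [e' ue'] : exists e' : nat -> F, u c = \sum_(h < size ws) e' h *: ws`_h.
    have ex (j : 'I_(size s)) : exists f : {ffun 'I_(size ws) -> F},
        s`_j == \sum_h f h *: ws`_h.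
      have [f ->] := wspan _ (mem_nth 0 (ltn_ord j)).
      by exists [ffun h : 'I_(size ws) => f h]; apply/eqP/eq_bigr => h _; rewrite ffunE.
    pose f j := xchoose (ex j).
    exists (fun h => if insub h is Some h' then \sum_(j < size s) e j * f j h' else 0).
    rewrite ue (eq_bigr (fun j : 'I_(size s) => \sum_h (e j * f j h) *: ws`_h)).
      by rewrite exchange_big /=; apply: eq_bigr => h _; rewrite valK scaler_suml.
    move=> j _; rewrite [in LHS](eqP (xchooseP (ex j))) scaler_sumr.
    by apply: eq_bigr => h _; rewrite scalerA.
  apply: dvdp_trans (dvdp_theta_wronskian u0 ue' ou).
  by apply: dvdp_exp2l; rewrite leq_sub2l // -!subn1 leq_sub2r.
have dv : \prod_(c <- pts) q c %| \det (theta_wronskian ws).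
  elim: (pts) upts qW => [|c l IHl]; first by rewrite big_nil dvd1p.
  move=> /= /andP[cl ul] qW; rewrite big_cons Gauss_dvdp.
    by rewrite qW ?mem_head //= IHl // => x xl; rewrite qW // inE xl orbT.
  rewrite big_seq; apply: (big_rec (coprimep (q c))); first exact: coprimep1.
  move=> x y xl cy; rewrite coprimepMr cy andbT.
  rewrite coprimep_expl // coprimep_expr // coprimep_XsubC root_XsubC.
  by apply: contraNneq cl => <-.
have sq : size (\prod_(c <- pts) q c)%R = (\sum_(c <- pts) (o c - (size s).-1)).+1.
  elim: (pts) => [|c l IHl]; first by rewrite !big_nil size_poly1.
  have q0 : q c != 0 by rewrite expf_neq0 // polyXsubC_eq0.
  have l0 : \prod_(c <- l) q c != 0 by rewrite -size_poly_gt0 IHl.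
  by rewrite !big_cons size_mul // size_exp_XsubC IHl addnS.
rewrite -ltnS -sq; apply: leq_trans (dvdp_leq W0 dv) (leq_trans szW _).
by rewrite ltnS leq_mul2r szw orbT.
Qed.

(** * Siegel's lemma *)

(** Pigeonhole on vectors with entries in [[0, B]]: [v j] takes values in an interval of length
    [2 c j B], cut into unit intervals by [truncn], and two vectors in one box differ by a solution.
    The forms are real, so the conclusion is [< 1]; integrality of norms will turn it into
    vanishing. *)
Lemma siegel_lemma (R : archiRealFieldType) (I J : finType) (l : J -> I -> R)
    (c : J -> R) (B : nat) :
  (forall j, \sum_i `|l j i| <= c j) -> (forall j, 1 <= c j) ->
  \prod_j (2%:R * c j * B.+1%:R) < B.+1%:R ^+ #|I| ->
  exists x : I -> int, [/\ exists i, x i != 0, forall i, `|x i| <= B%:Z &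
    forall j, `|\sum_i l j i * (x i)%:~R| < 1].
Proof.
move=> lc c1 lt_prod.
pose v j (y : {ffun I -> 'I_B.+1}) := \sum_i l j i * (y i)%:R.
have vle j y : `|v j y| <= c j * B%:R.
  apply: le_trans (ler_norm_sum _ _ _) _.
  apply: le_trans (_ : \sum_i `|l j i| * B%:R <= _).
    apply: ler_sum => i _; rewrite normrM ler_wpM2l // ger0_norm ?ler_nat //.
    by rewrite -ltnS.
  by rewrite -mulr_suml ler_wpM2r.
pose n j := Num.truncn (2%:R * c j * B%:R).
have vshift j y : 0 <= v j y + c j * B%:R <= 2%:R * c j * B%:R.
  by have := vle j y; rewrite ler_norml => /andP[lo hi]; apply/andP; split; lra.
have trunc_lt j y : (Num.truncn (v j y + c j * B%:R) < (n j).+1)%N.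
  rewrite ltnS; apply: le_truncn.
  by have /andP[] := vshift j y.
pose f y : {dffun forall j : J, 'I_(n j).+1} :=
  [ffun j => Ordinal (trunc_lt j y)].
have /injectivePn[y [y' yy' fy]] : ~~ injectiveb f.
  apply/negP => /injectiveP/leq_card; rewrite leqNgt => /negP; apply.
  rewrite card_dep_ffun card_ffun card_ord -(ltr_nat R) natrX.
  apply: le_lt_trans lt_prod.
  rewrite /image_mem -big_enum /=.
  elim: (enum _) => [|j r IHr]; first by rewrite big_nil.
  rewrite big_cons /= natrM ler_pM // card_ord.
  have nB : 0 <= 2%:R * c j * B%:R.
    by rewrite !mulr_ge0 // (le_trans _ (c1 j)).
  rewrite -natr1 -[B.+1%:R]natr1 mulrDr mulr1 lerD // ?truncn_le //.
  by have := c1 j; lra.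
exists (fun i => (y i)%:Z - (y' i)%:Z); split.
- apply/existsP; apply: contraNT yy' => /existsPn e.
  apply/eqP/ffunP => i; apply/val_inj; have /negPn := e i.
  by rewrite subr_eq0 => /eqP[].
- move=> i; rewrite ler_norml; have := ltn_ord (y i); have := ltn_ord (y' i); lia.
move=> j.
have -> : \sum_i l j i * (Posz (y i) - Posz (y' i))%:~R = v j y - v j y'.
  by rewrite -sumrB; apply: eq_bigr => i _; rewrite rmorphB mulrBr.
have /andP[y0 _] := vshift j y; have /andP[y'0 _] := vshift j y'.
have /andP[lo hi] := truncn_itv y0; have /andP[lo' hi'] := truncn_itv y'0.
have e : Num.truncn (v j y + c j * B%:R) = Num.truncn (v j y' + c j * B%:R).
  by have /ffunP/(_ j) := fy; rewrite !ffunE => -[].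
rewrite e -natr1 in lo hi; rewrite -natr1 in hi'.
by rewrite ltr_norml; apply/andP; split; lra.
Qed.

(** * Location of the roots of A *)

Local Open Scope complex_scope.

Lemma normr_complexE (R : rcfType) (z : R[i]) : `|z| = (normc z)%:C.
Proof. by case: z. Qed.

Lemma normc_ge0 (R : rcfType) (z : R[i]) : 0 <= normc z.
Proof. by rewrite -lecR -normr_complexE normr_ge0. Qed.

Lemma normcD (R : rcfType) (z w : R[i]) : normc (z + w) <= normc z + normc w.
Proof. by rewrite -lecR rmorphD -!normr_complexE ler_normD. Qed.

Lemma normcN (R : rcfType) (z : R[i]) : normc (- z) = normc z.
Proof. by apply: complexI; rewrite -!normr_complexE normrN. Qed.

Lemma normcB (R : rcfType) (z w : R[i]) : normc (z - w) <= normc z + normc w.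
Proof. by rewrite -(normcN w) normcD. Qed.

Lemma normc_distC (R : rcfType) (z w : R[i]) : normc (z - w) = normc (w - z).
Proof. by rewrite -normcN opprB. Qed.

Lemma lerB_normc (R : rcfType) (z w : R[i]) : normc z - normc w <= normc (z - w).
Proof. by rewrite lerBlDr -{1}(subrK w z) normcD. Qed.

Lemma normcX (R : rcfType) (z : R[i]) (n : nat) : normc (z ^+ n) = normc z ^+ n.
Proof. by apply: complexI; rewrite rmorphXn -!normr_complexE normrX. Qed.

Lemma normc_sum (R : rcfType) (I : Type) (r : seq I) (F : I -> R[i]) :
  normc (\sum_(i <- r) F i) <= \sum_(i <- r) normc (F i).
Proof.
rewrite -lecR -normr_complexE rmorph_sum /=.
by apply: le_trans (ler_norm_sum _ _ _) _; apply: ler_sum => i _; rewrite normr_complexE.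
Qed.

Lemma normc_prod (R : rcfType) (I : Type) (r : seq I) (F : I -> R[i]) :
  normc (\prod_(i <- r) F i) = \prod_(i <- r) normc (F i).
Proof.
apply: complexI; rewrite -normr_complexE rmorph_prod /= normr_prod.
by apply: eq_bigr => i _; rewrite normr_complexE.
Qed.

Lemma normc_real (R : rcfType) (x : R) : normc x%:C = `|x|.
Proof. by rewrite /= expr0n addr0 sqrtr_sqr. Qed.

Lemma normc_int (R : rcfType) (m : int) : normc (m%:~R : R[i]) = `|m|%:~R.
Proof. by rewrite -(rmorph_int (real_complex R)) normc_real intr_norm. Qed.

Lemma normc_nat (R : rcfType) (n : nat) : normc (n%:R : R[i]) = n%:R.
Proof. by rewrite -(rmorph_nat (real_complex R)) normc_real ger0_norm. Qed.

Lemma normc_eq0 (R : rcfType) (z : R[i]) : (normc z == 0) = (z == 0).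
Proof. by apply/eqP/eqP => [/eq0_normc|->]; rewrite ?normc0. Qed.

Lemma normc_horner_le (R : rcfType) (P : {poly R[i]}) (z : R[i]) (s : R) :
  1 <= s -> normc z <= s ->
  normc P.[z] <= (\sum_(i < size P) normc P`_i) * s ^+ (size P).-1.
Proof.
move=> s1 zs; rewrite horner_coef; apply: le_trans (normc_sum _ _) _.
rewrite mulr_suml; apply: ler_sum => i _.
rewrite normcM normcX ler_wpM2l ?normc_ge0 //.
apply: le_trans (_ : s ^+ i <= _);
  first by apply: lerXn2r; rewrite ?nnegrE ?normc_ge0 // (le_trans _ s1).
by apply: ler_weXn2l => //; have := ltn_ord i; lia.
Qed.

Lemma normc_prod_sub_ge (R : rcfType) (th : seq R[i]) (z : R[i]) (y : R) :
  0 <= y -> (forall t, t \in th -> y <= normc (z - t)) ->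
  y ^+ size th <= normc (\prod_(t <- th) (z - t)).
Proof.
move=> y0; rewrite normc_prod; elim: th => [|t th IHth] tz; first by rewrite big_nil.
rewrite big_cons exprS ler_pM ?exprn_ge0 //; first by apply: tz; rewrite mem_head.
by apply: IHth => u uth; apply: tz; rewrite inE uth orbT.
Qed.

(* Bootstrapping on (z - a) Q(z) = - P(z): a root with |z| > rho + 1 satisfies
   successively |z - a| <= L (rho + 1)^d0, |z - a| <= L and |z - a| < 1. *)
Lemma root_dichotomy (R : rcfType) (P : {poly R[i]}) (th : seq R[i]) (a z : R[i])
    (rho L : R) :
  0 <= rho -> 1 <= L -> \sum_(i < size P) normc P`_i = L ->
  (forall t, t \in th -> normc t <= rho) ->
  (2 * (size P).-1 < size th)%N ->
  L * 2%:R + 2%:R * rho + 2%:R <= normc a ->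
  L * (rho + 1) ^+ (size P).-1 + 2%:R * rho + 2%:R <= normc a ->
  (z - a) * \prod_(t <- th) (z - t) + P.[z] = 0 ->
  normc z <= rho + 1 \/ normc (z - a) < 1.
Proof.
move=> rho0 L1 PL thrho; set d0 := (size P).-1; set n := size th => dn La La' rz.
have [dn' nS] : (d0 <= n /\ d0 <= (n - d0).-1)%N /\ (n - d0 = (n - d0).-1.+1)%N.
  by clear -dn; lia.
have [|zrho] := lerP (normc z) (rho + 1); [by left|right].
set s := normc z in zrho; set e := normc (z - a).
have e0 : 0 <= e by apply: normc_ge0.
pose y := s - rho.
have y1 : 1 < y by rewrite /y; lra.
have ey : e * y ^+ n <= L * s ^+ d0.
  have : normc ((z - a) * \prod_(t <- th) (z - t)) <= L * s ^+ d0.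
    have -> : (z - a) * \prod_(t <- th) (z - t) = - P.[z].
      by apply/eqP; rewrite -addr_eq0 rz.
    by rewrite normcN -PL normc_horner_le //; lra.
  rewrite normcM; apply: le_trans; rewrite ler_wpM2l //.
  apply: normc_prod_sub_ge => [|t tth]; first lra.
  by apply: le_trans (lerB_normc _ _); have := thrho t tth; rewrite /y -/s; lra.
have sae : normc a - e <= s.
  have := lerB_normc a (a - z); rewrite opprB addrCA subrr addr0 -/s.
  by rewrite (normc_distC a z) -/e.
have yn : y ^+ n = y ^+ d0 * y ^+ (n - d0) by rewrite -exprD subnKC; case: dn'.
have yd0 : 0 < y ^+ d0 by rewrite exprn_gt0 //; lra.
(* Of the [n] factors of [Q], [d0] are spent on comparing [|z|^d0] with [(k y)^d0]. This is used
   with [k = rho + 1], then with [k = 2], once [y] is known to be at least [rho + 2]. *)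
have step (k : R) : 1 <= k -> s <= k * y -> e * y ^+ (n - d0) <= L * k ^+ d0.
  move=> k1 sk; rewrite -(ler_pM2l yd0) mulrCA -yn (le_trans ey) //.
  rewrite mulrCA -exprMn ler_wpM2l //; first lra.
  apply: lerXn2r; rewrite ?nnegrE; [exact: normc_ge0| |by rewrite mulrC].
  by apply: mulr_ge0; lra.
have e1 : e <= L * (rho + 1) ^+ d0.
  apply: le_trans (step (rho + 1) _ _); [|lra|]; last first.
    have : 0 <= rho * (s - (rho + 1)) by rewrite mulr_ge0 // subr_ge0 ltW.
    by rewrite /y !mulrBr !mulrDr !mulrDl; lra.
  by rewrite ler_peMr // exprn_ege1 // ltW.
have y2 : rho + 2%:R <= y by rewrite /y; lra.
have eL : e * y ^+ (n - d0) <= L * 2%:R ^+ d0 by apply: step; move: y2; rewrite /y; lra.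
have p2y k : 2%:R ^+ k <= y ^+ k by apply: lerXn2r; rewrite ?nnegrE; lra.
have e2 : e <= L.
  have yk : 0 < y ^+ (n - d0) by rewrite exprn_gt0 //; lra.
  rewrite -(ler_pM2r yk) (le_trans eL) // ler_wpM2l //; first lra.
  apply: le_trans (p2y (n - d0)%N); apply: ler_weXn2l; first lra.
  by rewrite nS leqW; case: dn'.
have y3 : L < y by rewrite /y; lra.
rewrite -(ltr_pM2r (exprn_gt0 (n - d0) (lt_trans ltr01 y1))) mul1r.
apply: le_lt_trans eL _; rewrite {1}nS exprS.
apply: lt_le_trans (_ : y * 2%:R ^+ d0 <= _).
  by rewrite ltr_pM2r // exprn_gt0.
rewrite ler_wpM2l //; first lra.
apply: le_trans (p2y _); apply: ler_weXn2l; [lra|by case: dn'].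
Qed.

(** The factor [S] on the left stands for the usual exponent [k - 1] on the right, so that [k = 0]
    is covered. *)
Lemma normc_exp_dist (R : rcfType) (z w : R[i]) (S : R) (k : nat) :
  0 <= S -> normc z <= S -> normc w <= S ->
  S * normc (z ^+ k - w ^+ k) <= k%:R * normc (z - w) * S ^+ k.
Proof.
move=> S0 zS wS; elim: k => [|k IHk].
  by rewrite !expr0 subrr normc0 !mulr0 !mul0r.
have -> : z ^+ k.+1 - w ^+ k.+1 = z * (z ^+ k - w ^+ k) + (z - w) * w ^+ k.
  by rewrite !exprS; ring.
apply: le_trans (ler_wpM2l S0 (normcD _ _)) _; rewrite !normcM normcX mulrDr.
have -> : k.+1%:R * normc (z - w) * S ^+ k.+1 =
   S * (k%:R * normc (z - w) * S ^+ k) + S * (normc (z - w) * S ^+ k).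
  by rewrite exprS -natr1; ring.
apply: lerD; rewrite ler_wpM2l //.
  apply: le_trans IHk; rewrite ler_wpM2r ?normc_ge0 //.
by rewrite ler_wpM2l ?normc_ge0 // lerXn2r ?nnegrE ?normc_ge0.
Qed.

Lemma normc_prod_inv_dist (R : rcfType) (th : seq R[i]) (z w : R[i]) (y : R) :
  0 < y -> (forall t, t \in th -> y <= normc (z - t)) ->
  (forall t, t \in th -> y <= normc (w - t)) ->
  normc (\prod_(t <- th) (z - t)^-1 - \prod_(t <- th) (w - t)^-1) <=
    (size th)%:R * normc (z - w) * y^-1 ^+ (size th).+1.
Proof.
move=> y0; elim: th => [|t th IHth] zt wt.
  by rewrite !big_nil subrr normc0 !mul0r.
have {IHth} IH : normc (\prod_(t <- th) (z - t)^-1 - \prod_(t <- th) (w - t)^-1) <=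
    (size th)%:R * normc (z - w) * y^-1 ^+ (size th).+1.
  by apply: IHth => u uth; [apply: zt|apply: wt]; rewrite inE uth orbT.
have inv_le u v : u \in t :: th -> (forall t', t' \in t :: th -> y <= normc (v - t')) ->
    normc (v - u)^-1 <= y^-1.
  move=> uth /(_ u uth) yv; rewrite normcV lef_pV2 ?posrE //.
  exact: lt_le_trans yv.
have prod_le : normc (\prod_(t <- th) (w - t)^-1) <= y^-1 ^+ size th.
  rewrite normc_prod -prodr_const_seq !big_seq ler_prod // => u uth.
  by rewrite normc_ge0 inv_le // inE uth orbT.
have nz v : (forall t', t' \in t :: th -> y <= normc (v - t')) -> v - t != 0.
  move=> /(_ _ (mem_head _ _)) yv; rewrite -normc_eq0.
  by apply: lt0r_neq0; apply: lt_le_trans yv.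
set U := \prod_(t <- th) (z - t)^-1 in IH *.
set V := \prod_(t <- th) (w - t)^-1 in IH prod_le *.
have -> : \prod_(t <- t :: th) (z - t)^-1 - \prod_(t <- t :: th) (w - t)^-1 =
   (z - t)^-1 * (U - V) + (w - z) * (z - t)^-1 * (w - t)^-1 * V.
  rewrite !big_cons -/U -/V; have := nz _ zt; have := nz _ wt => wz zz.
  by field; apply/andP.
apply: le_trans (normcD _ _) _; rewrite !normcM (normc_distC w z) /= -natr1.
have -> : ((size th)%:R + 1) * normc (z - w) * y^-1 ^+ (size th).+2 =
   y^-1 * ((size th)%:R * normc (z - w) * y^-1 ^+ (size th).+1) +
   normc (z - w) * y^-1 * y^-1 * y^-1 ^+ size th.
  by rewrite !exprS; ring.
have t0 := mem_head t th.
apply: lerD; first by rewrite ler_pM ?normc_ge0 // inv_le.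
apply: ler_pM; rewrite ?mulr_ge0 ?normc_ge0 //.
apply: ler_pM; rewrite ?mulr_ge0 ?normc_ge0 ?inv_le //.
by rewrite ler_wpM2l ?normc_ge0 ?inv_le.
Qed.

(* [z - a = - P(z) / Q(z)] and P / Q is a contraction on the disc [|z - a| < 1]. *)
Lemma near_root_unique (R : rcfType) (P : {poly R[i]}) (th : seq R[i])
    (a z w : R[i]) (rho L : R) :
  0 <= rho -> 1 <= L -> \sum_(i < size P) normc P`_i = L ->
  (forall t, t \in th -> normc t <= rho) ->
  (213 * (size P).-1 + 2200 <= 100 * size th)%N ->
  L * 2%:R + 2%:R * rho + 2%:R <= normc a ->
  normc (z - a) < 1 -> normc (w - a) < 1 ->
  (z - a) * \prod_(t <- th) (z - t) + P.[z] = 0 ->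
  (w - a) * \prod_(t <- th) (w - t) + P.[w] = 0 -> z = w.
Proof.
move=> rho0 L1 PL thrho; set d0 := (size P).-1; set n := size th => dn La za wa rz rw.
(* The Lipschitz constant will be at most [L b (d0 + n) 2^d0 b^(n - d0)] with [b <= 1/2] and
   [L b < 1], whence the need for [d0 + n <= 2^t] with [t = n - 2 d0]. Since [t >= 22], the linear
   bound [2^t >= 32 (t - 4)] is enough. *)
have [[d0n nE] [en ed]] : (d0 <= n /\ n = d0 + (n - d0))%N /\
    (d0 + n <= 2 ^ (n - d0 - d0))%N /\ (n - d0 = d0 + (n - d0 - d0))%N.
  have le_d0n : (d0 <= n)%N by clear -dn; lia.
  have lt_2 : (22 <= n - d0 - d0)%N by clear -dn; lia.
  split; [by clear -dn; lia|split; last by clear -dn; lia].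
  set t := (n - d0 - d0)%N in lt_2 *.
  have tE : (2 ^ t = 32 * 2 ^ (t - 5))%N.
    by rewrite -[32%N]/(2 ^ 5)%N -expnD subnKC // (leq_trans _ lt_2).
  have := ltn_expl (t - 5) (isT : 1 < 2)%N; rewrite tE.
  by move: (2 ^ (t - 5))%N lt_2; rewrite /t; clear -dn; lia.
pose y := normc a - 1 - rho; pose S := 2%:R * y; pose D := normc (z - w).
have y2 : 2%:R <= y by rewrite /y; lra.
have yL : L < y by rewrite /y; lra.
have D0 : 0 <= D by apply: normc_ge0.
have bnd v : normc (v - a) < 1 -> normc v <= S /\ forall t, t \in th -> y <= normc (v - t).
  move=> va; split.
    by have := lerB_normc v a; rewrite /S /y; lra.
  move=> t tth; have := lerB_normc v t; have := thrho t tth.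
  by have := lerB_normc a v; rewrite normc_distC /y; lra.
have [zS zt] := bnd z za; have [wS wt] := bnd w wa.
have y0 : 0 < y by lra.
have root_eq v : (forall t, t \in th -> y <= normc (v - t)) ->
    (v - a) * \prod_(t <- th) (v - t) + P.[v] = 0 ->
    v - a = - (P.[v] * \prod_(t <- th) (v - t)^-1).
  move=> vt /eqP; rewrite addr_eq0 => /eqP e.
  have Q0 : \prod_(t <- th) (v - t) != 0.
    rewrite prodf_seq_neq0; apply/allP => t /vt yv /=.
    rewrite -normc_eq0; apply: lt0r_neq0; exact: lt_le_trans yv.
  by rewrite prodfV -mulNr -e mulfK.
have Uz := root_eq z zt rz; have Vw := root_eq w wt rw.
set U := \prod_(t <- th) (z - t)^-1 in Uz; set V := \prod_(t <- th) (w - t)^-1 in Vw.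
have zw : z - w = (P.[w] - P.[z]) * U + P.[w] * (V - U).
  have -> : z - w = (z - a) - (w - a) by ring.
  by rewrite Uz Vw /U; ring.
pose b := y^-1.
have b0 : 0 < b by rewrite invr_gt0.
have yb : y * b = 1 by apply: mulfV; exact: lt0r_neq0.
have Lb : L * b < 1 by rewrite -yb (ltr_pM2r b0); exact: yL.
have b2 : 2%:R * b <= 1 by rewrite -[leRHS]yb (ler_pM2r b0).
have S1 : 1 <= S by rewrite /S; lra.
have S0 : 0 <= S by lra.
have nU : normc U <= b ^+ n.
  rewrite normc_prod -prodr_const_seq !big_seq ler_prod // => t tth.
  rewrite normc_ge0 normcV lef_pV2 ?posrE ?zt //; exact: lt_le_trans (zt t tth).
have nP : normc P.[w] <= L * S ^+ d0 by rewrite -PL normc_horner_le.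
have nUV : normc (V - U) <= n%:R * D * b ^+ n.+1.
  by rewrite normc_distC normc_prod_inv_dist.
have nPP : S * normc (P.[w] - P.[z]) <= L * (d0%:R * D * S ^+ d0).
  have -> : P.[w] - P.[z] = \sum_(k < size P) P`_k * (w ^+ k - z ^+ k).
    rewrite !horner_coef -sumrB; apply: eq_bigr => k _; by rewrite mulrBr.
  apply: le_trans (ler_wpM2l S0 (normc_sum _ _)) _; rewrite mulr_sumr -PL mulr_suml.
  apply: ler_sum => k _; rewrite normcM mulrCA ler_wpM2l ?normc_ge0 //.
  apply: le_trans (normc_exp_dist k S0 wS zS) _; rewrite (normc_distC w) -/D.
  have kd : (k <= d0)%N by rewrite -ltnS (leq_trans (ltn_ord k)) // leqSpred.
  by rewrite !ler_pM ?mulr_ge0 ?exprn_ge0 // ?ler_nat // ler_weXn2l.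
have nPP' : normc (P.[w] - P.[z]) <= b * (L * (d0%:R * D * S ^+ d0)).
  have : b * (S * normc (P.[w] - P.[z])) <= b * (L * (d0%:R * D * S ^+ d0)).
    by rewrite ler_wpM2l // ltW.
  apply: le_trans; rewrite /S mulrA (mulrCA b) (mulrC b y) yb mulr1.
  by rewrite ler_peMl ?normc_ge0 //; lra.
have key : D <= D * (L * b * ((d0 + n)%:R * (S ^+ d0 * b ^+ n))).
  rewrite {1}/D zw; apply: le_trans (normcD _ _) _; rewrite !normcM.
  have -> : D * (L * b * ((d0 + n)%:R * (S ^+ d0 * b ^+ n))) =
    b * (L * (d0%:R * D * S ^+ d0)) * b ^+ n + L * S ^+ d0 * (n%:R * D * b ^+ n.+1).
    by rewrite natrD exprS; ring.
  by apply: lerD; apply: ler_pM; rewrite ?normc_ge0.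
have small : (d0 + n)%:R * (S ^+ d0 * b ^+ n) <= 1.
  have -> : S ^+ d0 * b ^+ n = 2%:R ^+ d0 * b ^+ (n - d0).
    rewrite [X in b ^+ X]nE exprD mulrA; congr (_ * _).
    by rewrite -exprMn /S -mulrA yb mulr1.
  apply: le_trans (_ : 2%:R ^+ (n - d0) * b ^+ (n - d0) <= _).
    rewrite mulrA ler_wpM2r //; first by rewrite exprn_ge0 // ltW.
    rewrite ed exprD mulrC ler_wpM2l ?exprn_ge0 //.
    by rewrite -natrX ler_nat.
  rewrite -exprMn exprn_ile1 //; lra.
have lt1 : L * b * ((d0 + n)%:R * (S ^+ d0 * b ^+ n)) < 1.
  apply: le_lt_trans Lb; rewrite -[leRHS]mulr1 ler_wpM2l //.
  by rewrite mulr_ge0 // ltW //; lra.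
have D00 : D = 0 by apply/eqP; rewrite eq_le D0 andbT; nra.
by apply/eqP; rewrite -subr_eq0 -normc_eq0 -/D D00.
Qed.

(** * Irreducibility of A *)

Lemma monic_split_closed (C : closedFieldType) (G : {poly int}) :
  G \is monic -> exists s : seq C, map_poly intr G = \prod_(g <- s) ('X - g%:P).
Proof.
move=> monG; have [s e] := closed_field_poly_normal (map_poly intr G : {poly C}).
exists s; rewrite e.
have /monicP-> : map_poly intr G \is @monic C by rewrite monic_map.
by rewrite scale1r.
Qed.

Lemma no_small_factor (R : rcfType) (H Q : {poly int}) (s : seq R[i]) :
  H \is monic -> map_poly intr H = \prod_(g <- s) ('X - g%:P) ->
  (forall g, g \in s -> 0 < normc (map_poly intr Q).[g] < 1) -> s = [::].
Proof.
move=> monH Hs sQ; have [N e] := prod_horner_roots_int Q monH Hs.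
case: s sQ {Hs} e => // g s sQ e.
have lt1 : \prod_(z <- g :: s) normc (map_poly intr Q).[z] < 1.
  have gQ := sQ g (mem_head _ _).
  rewrite big_cons; apply: le_lt_trans (_ : normc (map_poly intr Q).[g] * 1 < 1).
    rewrite ler_wpM2l ?normc_ge0 // big_seq; apply: prodr_ile1 => z zs.
    have zgs : z \in g :: s by rewrite inE zs orbT.
    by rewrite normc_ge0 ltW //; case/andP: (sQ z zgs).
  by rewrite mulr1; case/andP: gQ.
have gt0 : 0 < \prod_(z <- g :: s) normc (map_poly intr Q).[z].
  by rewrite big_seq prodr_gt0 // => z /sQ/andP[].
move: lt1 gt0; rewrite -normc_prod e normc_int -[1]/(1%:~R) -[0]/(0%:~R).
by rewrite ltr_int ltr_int; lia.
Qed.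

(* In a factorisation of [A] over the integers the factor without the root [xi]
   is constant, since the product of the values of [Q] at its roots is an
   integer: hence [A] is irreducible. *)
Lemma conjugate_roots (R : rcfType) (A Q v : {poly int}) (rs : seq R[i])
    (xi g0 g : R[i]) :
  A \is monic -> map_poly intr A = \prod_(z <- rs) ('X - z%:P) ->
  count_mem xi rs = 1%N ->
  (forall z, z \in rs -> z != xi -> 0 < normc (map_poly intr Q).[z] < 1) ->
  g0 \in rs -> g \in rs -> root (map_poly intr v) g0 -> root (map_poly intr v) g.
Proof.
move=> monA Ars xi1 rsQ g0rs grs vg0.
have ratrE (p : {poly int}) :
    map_poly (@ratr R[i]) (map_poly intr p) = map_poly intr p.
  by rewrite -map_poly_comp; apply: eq_map_poly => m /=; rewrite ratr_int.
have Ag0 z : z \in rs -> root (map_poly (intr : int -> R[i]) A) z.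
  by move=> zrs; rewrite Ars root_prod_XsubC.
pose gc := gcdp (map_poly intr A : {poly rat}) (map_poly intr v).
have gcg0 : root (map_poly (@ratr R[i]) gc) g0.
  by rewrite gcdp_map !ratrE root_gcd Ag0.
(* By Gauss's lemma the rational gcd is, up to a scalar, an integer factor [G] of [A]; the leading
   coefficients of [G] and [F] are units, so both can be made monic. *)
have /dvdpP_rat_int[G [c c0 gcG] [F AE]] : gc %| map_poly intr A := dvdp_gcdl _ _.
have lcGF : lead_coef G * lead_coef F = 1.
  by rewrite -lead_coefM -AE; apply/eqP.
have uG : lead_coef G \is a GRing.unit by apply/unitrPr; exists (lead_coef F).
pose G1 := lead_coef F *: G; pose F1 := lead_coef G *: F.
have A1 : A = G1 * F1.
  by rewrite /G1 /F1 -scalerAl -scalerAr scalerA mulrC lcGF scale1r AE.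
have mG : G1 \is monic by rewrite monicE lead_coefZ mulrC lcGF.
have mF : F1 \is monic by rewrite monicE lead_coefZ lcGF.
have [sG Gs] := monic_split_closed R[i] mG.
have [sF Fs] := monic_split_closed R[i] mF.
have pGF : perm_eq rs (sG ++ sF).
  by apply: prod_XsubC_eq; rewrite -Ars A1 rmorphM /= Gs Fs big_cat.
have subQ (s : seq R[i]) : {subset s <= rs} -> xi \notin s ->
    forall z, z \in s -> 0 < normc (map_poly intr Q).[z] < 1.
  move=> sub xs z zs; apply: rsQ; first exact: sub.
  by apply: contraNneq xs => <-.
have subG : {subset sG <= rs} by move=> z zs; rewrite (perm_mem pGF) mem_cat zs.
have subF : {subset sF <= rs} by move=> z zs; rewrite (perm_mem pGF) mem_cat zs orbT.
have F0 : lead_coef F != 0.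
  by apply: contra_eq_neq lcGF => ->; rewrite mulr0 eq_sym oner_neq0.
have rootG z : z \in sG -> root (map_poly intr v) z.
  move=> zs; have : root (map_poly (intr : int -> R[i]) G1) z.
    by rewrite Gs root_prod_XsubC.
  rewrite map_polyZ rootZ ?intr_eq0 // => Gz.
  have : root (map_poly (@ratr R[i]) gc) z.
    by rewrite gcG map_polyZ ratrE rootZ ?fmorph_eq0.
  by rewrite gcdp_map !ratrE root_gcd => /andP[].
(* If xi is a root of [G], the cofactor has no roots and every conjugate is a root of the gcd, hence
   of [v]; otherwise [G] itself has no roots, contrary to [g0]. *)
have [xG|xG] := boolP (xi \in sG).
  have xF : xi \notin sF.
    rewrite -has_pred1 has_count in xG; rewrite -has_pred1 has_count.
    by move: xi1; rewrite (seq.permP pGF) count_cat; move: xG; lia.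
  have sF0 := no_small_factor mF Fs (subQ _ subF xF).
  by apply: rootG; rewrite (perm_mem pGF) sF0 cats0 in grs.
have sG0 := no_small_factor mG Gs (subQ _ subG xG).
have : root (map_poly (intr : int -> R[i]) G1) g0.
  rewrite map_polyZ rootZ ?intr_eq0 //; move: gcg0.
  by rewrite gcG map_polyZ ratrE rootZ ?fmorph_eq0.
by rewrite Gs sG0 root_prod_XsubC.
Qed.

(** Simplicity of xi by Vieta: the degree of [P] is at most [size rs - 2], so the roots of [A] sum
    to [a] plus the roots of [Q]. If xi occurred [c >= 2] times, [(c - 1) |a|] would be at most
    [c + 2 (size rs) (rho + 1)], against the lower bound on [|a|]. *)
Lemma sum_roots_near (R : rcfType) (P : {poly R[i]}) (th rs : seq R[i]) (a xi : R[i])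
    (rho : R) :
  \prod_(z <- rs) ('X - z%:P) = ('X - a%:P) * \prod_(t <- th) ('X - t%:P) + P ->
  (size P <= size th)%N -> 0 <= rho ->
  (forall t, t \in th -> normc t <= rho) ->
  (forall z, z \in rs -> normc z <= rho + 1 \/ z = xi) ->
  xi \in rs -> normc (xi - a) < 1 ->
  2%:R * (size rs)%:R * (rho + 1) + 2%:R < normc a ->
  count_mem xi rs = 1%N /\ size rs = (size th).+1.
Proof.
move=> rsE Pth rho0 thrho rsxi xirs xia aL.
have {}rsE : \prod_(z <- rs) ('X - z%:P) = \prod_(t <- a :: th) ('X - t%:P) + P.
  by rewrite big_cons.
have szE : size rs = (size th).+1.
  have : size (\prod_(z <- rs) ('X - z%:P)) = (size th).+2.
    rewrite rsE size_polyDl; last by rewrite size_prod_XsubC ltnS leqW.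
    by rewrite size_prod_XsubC.
  by rewrite size_prod_XsubC => -[].
split=> //; set n := size th in Pth szE.
have sumE : \sum_(z <- rs) z = a + \sum_(t <- th) t.
  have := congr1 (fun p : {poly _} => p`_n) rsE.
  rewrite coefD [P`_n]nth_default // addr0.
  have -> : n = (size rs).-1 by rewrite szE.
  rewrite coefPn_prod_XsubC ?szE // -[n]/(size (a :: th)).-1.
  by rewrite coefPn_prod_XsubC // big_cons => /oppr_inj.
have c0 : (0 < count_mem xi rs)%N by rewrite -has_count has_pred1.
set c := count_mem xi rs in c0 *.
have splitE : \sum_(z <- rs) z = c%:R * xi + \sum_(z <- rs | z != xi) z.
  rewrite (bigID (pred1 xi)) /=; congr (_ + _).
  rewrite (eq_bigr (fun=> xi)); last by move=> z /eqP.
  by rewrite big_const_seq iter_addr_0 mulr_natl.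
have rest : normc (\sum_(z <- rs | z != xi) z) <= (size rs)%:R * (rho + 1).
  rewrite big_mkcond /=; apply: le_trans (normc_sum _ _) _.
  rewrite -sum1_size natr_sum mulr_suml !big_seq; apply: ler_sum => z zrs.
  rewrite mul1r; case: eqVneq => [_|zxi]; first by rewrite normc0; lra.
  by have [//|/eqP] := rsxi z zrs; rewrite (negPf zxi).
have thle : normc (\sum_(t <- th) t) <= (size rs)%:R * (rho + 1).
  apply: le_trans (normc_sum _ _) _.
  apply: le_trans (_ : (size th)%:R * (rho + 1) <= _); last first.
    by rewrite szE ler_wpM2r ?ler_nat //; lra.
  rewrite -sum1_size natr_sum mulr_suml !big_seq; apply: ler_sum => t /thrho.
  by rewrite mul1r; lra.
have : (c.-1)%:R * normc a <= c%:R + 2%:R * ((size rs)%:R * (rho + 1)).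
  have -> : (c.-1)%:R * normc a = normc (\sum_(t <- th) t
      - \sum_(z <- rs | z != xi) z - c%:R * (xi - a)).
    have -> : \sum_(t <- th) t - \sum_(z <- rs | z != xi) z - c%:R * (xi - a) =
        c.-1%:R * a.
      have -> : \sum_(t <- th) t = c%:R * xi + \sum_(z <- rs | z != xi) z - a.
        by rewrite -splitE sumE addrC addKr.
      have -> : c%:R = c.-1%:R + 1 :> R[i] by rewrite natr1 prednK.
      by ring.
    by rewrite normcM normc_nat.
  have cx : normc (c%:R * (xi - a)) <= c%:R.
    rewrite normcM normc_nat.
    by rewrite ler_piMr // ltW.
  have := normcB (\sum_(t <- th) t - \sum_(z <- rs | z != xi) z) (c%:R * (xi - a)).
  have := normcB (\sum_(t <- th) t) (\sum_(z <- rs | z != xi) z).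
  lra.
case: c c0 {splitE} => [//|[//|c]] _ /= le_c.
have := ler0n R c; rewrite -(@natr1 _ c.+1) -natr1 in le_c *.
have : 0 <= 2%:R * (size rs)%:R * (rho + 1) by rewrite !mulr_ge0 //; lra.
move: aL le_c; rewrite -!mulrA; set s := (size rs)%:R * (rho + 1).
move: (c%:R : R) (normc a) s => x A s {}aL le_c s0 x0; exfalso.
by have : 0 <= s * x; [rewrite mulr_ge0 //; lra | nra].
Qed.

(** * Polynomials in two variables *)

Lemma horner_polyn (K : comNzRingType) (n : nat) (E : nat -> K) (x : K) :
  (\poly_(k < n) E k).[x] = \sum_(k < n) E k * x ^+ k.
Proof.
rewrite poly_def horner_sum; apply: eq_bigr => k _.
by rewrite hornerZ hornerXn.
Qed.

(** Divided derivatives keep integer polynomials integral without introducing factorials into the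
    estimates; composing them costs only this binomial coefficient. *)
Lemma nderivn_nderivn (K : comNzRingType) (i m : nat) (p : {poly K}) :
  p^`N(i)^`N(m) = p^`N(i + m) *+ 'C(i + m, i).
Proof.
apply/polyP=> k; rewrite coefMn !coef_nderivn -!mulrnA addnA.
congr (_ *+ _).
have e1 := bin_fact (leq_addr (m + k) i); have e2 := bin_fact (leq_addr k m).
have e3 := bin_fact (leq_addr k (i + m)); have e4 := bin_fact (leq_addr m i).
rewrite !addKn addnA in e1 e2 e3 e4.
have p0 : (0 < i`! * m`! * k`!)%N by rewrite !muln_gt0 !fact_gt0.
apply/eqP; rewrite -(eqn_pmul2r p0); apply/eqP.
transitivity (i + m + k)`!; [rewrite -e1 -e2|rewrite -e3 -e4]; ring.
Qed.

Lemma nderivn_taylor_at (K : comNzRingType) (p : {poly K}) (x y : K) (i n : nat) :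
  (size p <= n)%N ->
  p^`N(i).[y] = \sum_(m < n) p^`N(i + m).[x] * (y - x) ^+ m *+ 'C(i + m, i).
Proof.
move=> pn; have -> : y = x + (y - x) by rewrite addrC subrK.
rewrite [in RHS](addrC x) addrK.
rewrite (@nderiv_taylor_wide _ n) //; first last.
- apply: leq_trans pn; apply/leq_sizeP => j pj.
  by rewrite coef_nderivn nth_default ?mul0rn // (leq_trans pj) ?leq_addl.
- exact: mulrC.
apply: eq_bigr => m _.
by rewrite nderivn_nderivn hornerMn mulrnAl.
Qed.

Lemma dvdp_XsubC_nderivn (K : fieldType) (p : {poly K}) (c : K) (T : nat) :
  (forall i, (i < T)%N -> p^`N(i).[c] = 0) -> ('X - c%:P) ^+ T %| p.
Proof.
move=> pc.
have -> : p = \sum_(i < size p) (p^`N(i).[c])%:P * ('X - c%:P) ^+ i.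
  rewrite -[LHS]comp_polyXr /comp_poly.
  have {1}-> : 'X = c%:P + ('X - c%:P) by rewrite addrC subrK.
  rewrite nderiv_taylor; last exact: mulrC.
  rewrite size_map_polyC; apply: eq_bigr => i _.
  by rewrite nderivn_map horner_map.
apply: (big_ind (dvdp _)) => [||i _]; first exact: dvdp0.
  by move=> *; apply: dvdp_add.
have [/pc->|Ti] := ltnP i T; first by rewrite mul0r dvdp0.
by apply: dvdp_mull; apply: dvdp_exp2l.
Qed.

Lemma exists_vanishing_order (K : fieldType) (p : {poly K}) (c : K) : p != 0 ->
  exists2 m : nat, ('X - c%:P) ^+ m %| p & p^`N(m).[c] != 0.
Proof.
move=> p0; have ex : exists m, p^`N(m).[c] != 0.
  apply: contrapT => none.
  have : ('X - c%:P) ^+ (size p) %| p.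
    apply: dvdp_XsubC_nderivn => i _; apply/eqP/negPn/negP => ci.
    by apply: none; exists i.
  by move/(dvdp_leq p0); rewrite size_exp_XsubC ltnn.
exists (ex_minn ex); case: ex_minnP => m cm mmin //.
apply: dvdp_XsubC_nderivn => i im; apply/eqP/negPn/negP => /mmin.
by rewrite leqNgt im.
Qed.

(* A polynomial in two variables [sum_(k < M) g_k(y) x^k] is given by its
   coefficients [g_k]; [aux_diag M i g] is its [i]-th divided [x]-derivative on the
   diagonal. *)
Definition aux_at (K : comNzRingType) (M : nat) (g : nat -> {poly int}) (y : K) :
    {poly K} :=
  \poly_(k < M) (map_poly intr (g k)).[y].

Definition aux_diag (M i : nat) (g : nat -> {poly int}) : {poly int} :=
  \sum_(k < M) (g k * 'X^(k - i)) *+ 'C(k, i).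

Lemma nderivn_aux_at (K : comNzRingType) (M i : nat) (g : nat -> {poly int})
    (x y : K) :
  (aux_at M g y)^`N(i).[x] =
  \sum_(k < M) (map_poly intr (g k)).[y] * x ^+ (k - i) *+ 'C(k, i).
Proof.
rewrite /aux_at poly_def linear_sum /= horner_sum; apply: eq_bigr => k _.
by rewrite nderivnZ nderivnXn hornerZ hornerMn hornerXn mulrnAr.
Qed.

Lemma nderivn_aux_at_diag (K : comNzRingType) (M i : nat)
    (g : nat -> {poly int}) (y : K) :
  (aux_at M g y)^`N(i).[y] = (map_poly intr (aux_diag M i g)).[y].
Proof.
rewrite nderivn_aux_at rmorph_sum horner_sum; apply: eq_bigr => k _.
by rewrite rmorphMn rmorphM /= map_polyXn hornerMn hornerM hornerXn.
Qed.

(** The coefficients of [r] are read off from the lowest up: [|pr_0| |r_j| <= H + |pr_1| |r_(j-1)|],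
    and a constant term exceeding the leading coefficient by 2 in modulus propagates
    [|r_j| <= H / 2]. *)
Lemma coef_quotient_bound (pr g r : {poly int}) (H : nat) :
  size pr = 2%N -> `|pr`_1| + 2%:Z <= `|pr`_0| -> g = pr * r ->
  (forall j, `|g`_j| <= H%:Z) -> forall j, `|r`_j| <= (H./2)%:Z.
Proof.
move=> spr pr01 gE gH.
have coefE j : g`_j = (if j is j'.+1 then pr`_1 * r`_j' else 0) + pr`_0 * r`_j.
  have -> : g = pr`_1 *: ('X * r) + pr`_0 *: r.
    rewrite gE {1}(_ : pr = pr`_1 *: 'X + (pr`_0)%:P).
      by rewrite mulrDl -scalerAl mul_polyC.
    apply/polyP => -[|[|k]]; rewrite coefD coefZ coefX coefC /= ?mulr0 ?add0r ?mulr1 ?addr0 //.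
    by rewrite nth_default // spr.
  by rewrite coefD !coefZ coefXM; case: j => [|j] //=; rewrite mulr0.
have step j : `|pr`_0| * `|r`_j| <= H%:Z + (if j is j'.+1 then `|pr`_1| * `|r`_j'| else 0).
  have := coefE j; case: j => [|j] e.
    by rewrite -normrM addr0; move: e (gH 0%N); rewrite add0r => ->.
  rewrite -!normrM; have -> : pr`_0 * r`_j.+1 = g`_j.+1 - pr`_1 * r`_j.
    by rewrite e addrC addKr.
  apply: le_trans (ler_normB _ _) _; rewrite lerD2r; exact: gH.
suff le2 j : `|r`_j| * 2%:Z <= H%:Z by move=> j; have := le2 j; lia.
elim: j => [|j IHj].
  have := step 0%N; rewrite addr0; have := normr_ge0 r`_0; have := normr_ge0 pr`_1.
  move: `|pr`_0| `|pr`_1| `|r`_0| pr01 => A B C; clear; nia.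
have := step j.+1; have := normr_ge0 r`_j; have := normr_ge0 r`_j.+1.
have := normr_ge0 pr`_1; move: `|pr`_0| `|pr`_1| `|r`_j| `|r`_j.+1| IHj pr01.
clear; move=> A B C D; nia.
Qed.

(** [rs] will list all roots of [A]: vanishing at each [(z, z)] lets the zero estimate count [d]
    points. Only the [g k] with [k < M] enter the polynomial, so one of these has to be nonzero. *)
Definition aux_solution (K : comNzRingType) (M N T H : nat) (rs : seq K)
    (g : nat -> {poly int}) : Prop :=
  [/\ forall k, (size (g k) <= N)%N,
      exists2 k, (k < M)%N & g k != 0,
      forall k j, `|(g k)`_j| <= H%:Z &
      forall i z, (i < T)%N -> z \in rs ->
        root (map_poly intr (aux_diag M i g)) z].

(* Dividing a solution by the primitive part of [q y - p] halves its height, so a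
   solution of minimal height does not vanish identically on [y = p / q]. *)
Lemma aux_solution_nonzero (K : numFieldType) (M N T : nat) (rs : seq K) (p q : int) :
  1 <= q -> 3%:Z * q <= `|p| -> (forall z, z \in rs -> q%:~R * z != p%:~R) ->
  forall (H : nat) (g : nat -> {poly int}), aux_solution M N T H rs g ->
  exists2 g', aux_solution M N T H rs g' & aux_at M g' (p%:~R / q%:~R : rat) != 0.
Proof.
move=> q1 pq rsz H; have [n] := ubnP H; elim: n H => // n IHn H /ltnSE Hn g sol_g.
have [szg [k0 k0M gk0] gH vg] := sol_g.
have [at0|] := eqVneq (aux_at M g (p%:~R / q%:~R : rat)) 0; last by exists g.
pose l : {poly int} := q *: 'X - p%:P.
have l1 : l`_1 = q by rewrite coefB coefZ coefX coefC mulr1 subr0.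
have l0 : l`_0 = - p by rewrite coefB coefZ coefX coefC mulr0 sub0r.
have q0 : q != 0 by apply: contraTneq q1 => ->.
have szl : size l = 2%N.
  rewrite size_polyDl ?size_scale ?size_polyX // size_polyN.
  by rewrite (leq_ltn_trans (size_polyC_leq1 _)).
set pr := zprimitive l; set t := zcontents l.
have lE : l = t *: pr by rewrite {1}(zpolyEprim l).
have t0 : t != 0 by rewrite zcontents_eq0 -size_poly_gt0 szl.
have szpr : size pr = 2%N by rewrite -szl lE size_scale.
have prq : `|t| * `|pr`_1| = q.
  by rewrite -normrM -coefZ -lE l1 ger0_norm //; lia.
have prp : `|t| * `|pr`_0| = `|p|.
  by rewrite -normrM -coefZ -lE l0 normrN.
have t1 : 1 <= `|t| by have := normr_gt0 t; rewrite t0; lia.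
have pr1 : 1 <= `|pr`_1|.
  have : pr`_1 != 0 by apply: contraNneq q0 => e; rewrite -prq e normr0 mulr0.
  by rewrite -normr_gt0; lia.
(* From [3 q <= |p|] and [|pr_1| >= 1]: [|pr_0| >= 3 |pr_1| >= |pr_1| + 2]. *)
have pr01 : `|pr`_1| + 2%:Z <= `|pr`_0|.
  rewrite -prq -prp in pq; move: (`|t|) (`|pr`_1|) (`|pr`_0|) pq t1 pr1 => a b c.
  clear; move=> pq a1 b1; have : 3%:Z * b <= c by nia.
  lia.
have dv (k : 'I_M) : exists r, g k == pr * r.
  have rk : root (map_poly intr (g k) : {poly rat}) (p%:~R / q%:~R).
    have := congr1 (fun P : {poly rat} => P`_k) at0.
    by rewrite coef_poly ltn_ord coef0 => e; apply/rootP.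
  have dl : (map_poly intr l : {poly rat}) %| map_poly intr (g k).
    have -> : map_poly intr l = q%:~R *: ('X - (p%:~R / q%:~R)%:P) :> {poly rat}.
      rewrite /l rmorphB /= map_polyZ map_polyX map_polyC /= scalerBr.
      by rewrite -[_ *: _%:P]mul_polyC -polyCM mulrC divfK // intr_eq0.
    by rewrite dvdpZl ?intr_eq0 // dvdp_XsubCl.
  rewrite dvdp_rat_int in dl; have [r e] := dvdpP_int dl.
  by exists r; apply/eqP.
pose g' k := if insub k is Some k' then xchoose (dv k') else 0.
have g'E k (lt_kM : (k < M)%N) : g k = pr * g' k.
  rewrite /g' insubT; exact/eqP/(xchooseP (dv (Sub k lt_kM))).
have g'0 k : (M <= k)%N -> g' k = 0.
  by move=> Mk; rewrite /g' insubF // ltnNge Mk.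
have H0 : (H./2 < H)%N.
  have : (0 < H)%N.
    case: H gH {IHn Hn sol_g} => // gH; case/negP: gk0; apply/eqP/polyP => j.
    by have := gH k0 j; rewrite coef0 normr_le0 => /eqP.
  by clear; lia.
have prz z : z \in rs -> (map_poly intr pr).[z] != 0.
  move=> /rsz; apply: contraNneq => e.
  have : (map_poly intr l).[z] = 0 by rewrite lE map_polyZ hornerZ e mulr0.
  rewrite /l rmorphB /= map_polyZ map_polyX map_polyC /= !hornerE.
  by move=> /eqP; rewrite subr_eq0.
have sol' : aux_solution M N T H./2 rs g'.
  split.
  - move=> k; have [lt_kM|le_Mk] := ltnP k M; last by rewrite g'0 // size_poly0.
    have [->|n0] := eqVneq (g' k) 0; first by rewrite size_poly0.
    apply: leq_trans (szg k); rewrite g'E // size_mul // ?szpr ?leqnSn //.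
    by rewrite -size_poly_gt0 szpr.
  - exists k0 => //; apply: contraNneq gk0 => e; by rewrite g'E // e mulr0.
  - move=> k j; have [lt_kM|le_Mk] := ltnP k M; last by rewrite g'0 // coef0.
    exact: (coef_quotient_bound szpr pr01 (g'E _ lt_kM) (gH k)).
  move=> i z iT zrs; have := vg i z iT zrs.
  have -> : aux_diag M i g = pr * aux_diag M i g'.
    rewrite /aux_diag mulr_sumr; apply: eq_bigr => k _.
    by rewrite g'E // -mulrA mulrnAr.
  by rewrite rmorphM /= rootM => /orP[|//]; rewrite /root (negPf (prz z zrs)).
have [|g'' [s1 s2 s3 s4] at''] := IHn _ _ g' sol'.
  exact: leq_trans H0 Hn.
exists g'' => //; split => // k j; apply: le_trans (s3 k j) _.
by rewrite lez_nat ltnW.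
Qed.

Lemma map_aux_at (K K' : comNzRingType) (f : {rmorphism K -> K'}) (M : nat)
    (g : nat -> {poly int}) (y : K) :
  map_poly f (aux_at M g y) = aux_at M g (f y).
Proof.
apply/polyP => k; rewrite coef_map !coef_poly; case: ifP => _; last exact: rmorph0.
rewrite -[LHS](horner_map f) -map_poly_comp; congr (_.[_]).
by apply: eq_map_poly => m /=; rewrite rmorph_int.
Qed.

Lemma aux_at_lin (K : comNzRingType) (M N : nat) (g : nat -> {poly int}) (y : K) :
  (forall k, (size (g k) <= N)%N) ->
  aux_at M g y =
  \sum_(j < N) y ^+ j *: \poly_(k < M) ((g k)`_j)%:~R.
Proof.
move=> szg; apply/polyP => k; rewrite coef_poly coef_sum.
have [lt_kM|le_Mk] := ltnP k M; last first.
  by rewrite big1 // => j _; rewrite coefZ coef_poly ltnNge le_Mk mulr0.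
rewrite (@horner_coef_wide _ N); last first.
  by apply: leq_trans (size_poly _ _) (szg k).
by apply: eq_bigr => j _; rewrite coef_map coefZ coef_poly lt_kM mulrC.
Qed.

Lemma aux_at_eq0 (K : numFieldType) (M : nat) (g : nat -> {poly int}) (y : K)
    (k : nat) :
  aux_at M g y = 0 -> (k < M)%N -> root (map_poly intr (g k)) y.
Proof.
move=> at0 kM; have := congr1 (fun P : {poly K} => P`_k) at0.
by rewrite coef_poly kM coef0 => e; apply/rootP.
Qed.

(** The zero estimate is applied to the coefficients [U j] of the powers of the second variable. At
    [c] in [rs] the combination [aux_at M g c] has order at least [T], and it is nonzero because [c]
    is no root of a nonzero integer polynomial of degree at most [n]; at the extra point [x] the
    combination [aux_at M g y] has exact order [m]. The final [+ n] makes up for the truncated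
    [m - n]. *)
Lemma aux_nonvanishing (K : numFieldType) (M n T H : nat) (rs : seq K)
    (g : nat -> {poly int}) (x y : K) :
  aux_solution M n.+1 T H rs g -> uniq rs -> x \notin rs ->
  (forall v : {poly int}, v != 0 -> (size v <= n.+1)%N ->
     forall z, z \in rs -> ~~ root (map_poly intr v) z) ->
  aux_at M g y != 0 ->
  exists2 i, (i + size rs * (T - n) <= n.+1 * M.-1 + n)%N &
    (aux_at M g y)^`N(i).[x] != 0.
Proof.
move=> [szg [k0 k0M gk0] _ vg] urs xrs irr aty.
have [m dm am] := exists_vanishing_order x aty.
exists m => //.
pose U (j : nat) : {poly K} := \poly_(k < M) ((g k)`_j)%:~R.
pose s := [seq U j | j <- iota 0 n.+1].
pose u (c : K) := if c == x then aux_at M g y else aux_at M g c.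
pose o (c : K) := if c == x then m else T.
have szs : size s = n.+1 by rewrite size_map size_iota.
have lin (z : K) : exists e : nat -> K, aux_at M g z = \sum_(j < size s) e j *: s`_j.
  exists (fun j => z ^+ j); rewrite (aux_at_lin M z szg) szs.
  by apply: eq_bigr => j _; rewrite (nth_map 0%N) ?size_iota // nth_iota.
have bnd : (\sum_(c <- x :: rs) (o c - n) <= n.+1 * M.-1)%N.
  suff : (\sum_(c <- x :: rs) (o c - (size s).-1) <= size s * M.-1)%N by rewrite szs.
  apply: (@sum_vanishing_orders_le K M.-1 s (x :: rs) u o).
  - move=> p /mapP[j _ ->]; apply: leq_trans (size_poly _ _) _.
    by case: (M) k0M.
  - by rewrite /= xrs.
  move=> c; rewrite inE /u /o; case: eqVneq => [-> _|cx /= crs] //; split=> //.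
    apply: contraNneq (irr _ gk0 (szg k0) c crs) => e; exact: aux_at_eq0 e k0M.
  apply: dvdp_XsubC_nderivn => i iT; rewrite nderivn_aux_at_diag.
  by apply/rootP; apply: vg.
rewrite big_cons {1}/o eqxx in bnd.
have e : (\sum_(c <- rs) (o c - n) = size rs * (T - n))%N.
  rewrite -sum1_size big_distrl /= !big_seq; apply: eq_bigr => c crs.
  by rewrite mul1n /o; case: eqVneq => // cx; rewrite cx (negPf xrs) in crs.
by move: bnd; rewrite e; clear; lia.
Qed.

Lemma normc_le_ReIm (R : rcfType) (z : R[i]) : normc z <= `|complex.Re z| + `|complex.Im z|.
Proof.
case: z => x y /=; rewrite -(ler_pXn2r (ltn0Sn 1)) ?nnegrE ?sqrtr_ge0 ?addr_ge0 //.
rewrite sqr_sqrtr ?addr_ge0 ?sqr_ge0 // sqrrD !real_normK ?num_real //.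
have := mulr_ge0 (normr_ge0 x) (normr_ge0 y).
by rewrite -mulr_natr; lra.
Qed.

Lemma Re_le_normc (R : rcfType) (z : R[i]) : `|complex.Re z| <= normc z.
Proof. by case: z => x y /=; rewrite -sqrtr_sqr ler_wsqrtr // lerDl sqr_ge0. Qed.

Lemma Im_le_normc (R : rcfType) (z : R[i]) : `|complex.Im z| <= normc z.
Proof. by case: z => x y /=; rewrite -sqrtr_sqr ler_wsqrtr // lerDr sqr_ge0. Qed.

Lemma bin_le_2exp (k i : nat) : ('C(k, i) <= 2 ^ k)%N.
Proof.
have [le_ik|lt_ki] := leqP i k; last by rewrite bin_small.
rewrite -[2%N]/(1 + 1)%N expnDn (bigD1 (Ordinal (le_ik : (i < k.+1)%N))) //=.
by rewrite !exp1n !muln1 leq_addr.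
Qed.

Lemma sum_bin_le (M i : nat) : (\sum_(k < M) 'C(k, i) <= 2 ^ M)%N.
Proof.
elim: M => [|M IHM]; first by rewrite big_ord0.
by rewrite big_ord_recr /= expnS mul2n -addnn leq_add // bin_le_2exp.
Qed.

(** * Construction of the auxiliary polynomial *)

Definition ReIm (R : rcfType) (z w : R[i]) : R :=
  if 0 <= complex.Im z then complex.Re w else complex.Im w.

Lemma ReIm_sum (R : rcfType) (z : R[i]) (I : Type) (r : seq I) (F : I -> R[i]) :
  ReIm z (\sum_(i <- r) F i) = \sum_(i <- r) ReIm z (F i).
Proof.
rewrite /ReIm; elim: r => [|i r IHr]; first by rewrite !big_nil; case: ifP.
rewrite !big_cons; move: IHr; case: ifP => _ <-;
  by case: (F i) => ? ?; case: (\sum_(j <- r) F j).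
Qed.

Lemma ReIm_int (R : rcfType) (z w : R[i]) (m : int) :
  ReIm z (w * m%:~R) = ReIm z w * m%:~R.
Proof.
rewrite -(rmorph_int (real_complex R)) /ReIm; case: w => u v /=.
by case: ifP => _; rewrite !mulr0 ?subr0 ?add0r.
Qed.

Lemma ReIm_le_normc (R : rcfType) (z w : R[i]) : `|ReIm z w| <= normc w.
Proof. by rewrite /ReIm; case: ifP => _; rewrite ?Re_le_normc ?Im_le_normc. Qed.

Lemma horner_int_conjc (R : rcfType) (v : {poly int}) (z : R[i]) :
  (map_poly intr v).[conjc z] = conjc (map_poly intr v).[z].
Proof.
rewrite -horner_map -map_poly_comp; congr (_.[_]).
by apply: eq_map_poly => m /=; rewrite rmorph_int.
Qed.

(* A non-real pair of conjugate values is controlled by one real part and one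
   imaginary part, so that d values of an integer polynomial cost d real forms. *)
Lemma normc_lt1_ReIm (R : rcfType) (v : {poly int}) (z : R[i]) :
  `|2%:R * ReIm z (map_poly intr v).[z]| < 1 ->
  `|2%:R * ReIm (conjc z) (map_poly intr v).[conjc z]| < 1 ->
  normc (map_poly intr v).[z] < 1.
Proof.
have vz := horner_int_conjc v z; rewrite vz.
move: vz; move E : (map_poly intr v).[z] => w vz; have le_w := normc_le_ReIm w.
have n2 : `|2%:R| = 2%:R :> R by rewrite ger0_norm.
rewrite !normrM n2 /ReIm.
case: z E vz => x y E vz; case: w E vz le_w => u t E vz le_w /=; rewrite oppr_ge0.
case: (ltgtP y 0) => y0; rewrite ?normrN /=.
- by move: le_w => /=; lra.
- by move: le_w => /=; lra.
have : conjc (x +i* y) = x +i* y by rewrite /= y0 oppr0.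
move=> zr; rewrite zr E in vz; case: vz => tt.
have t0 : t = 0 by lra.
by move: le_w; rewrite /= t0 normr0; lra.
Qed.

(** There is one real form for each root and each [i < T]. Each root has its own bound [s z], so
    that the size of [a] is charged to xi alone. The 4 is 2 from Siegel's lemma and 2 from the
    scaling that brings real and imaginary parts below 1/2; [2^M] bounds a sum of binomials. *)
Lemma siegel_aux (R : realType) (M n T B : nat) (rs : seq R[i]) (s : R[i] -> R) :
  (forall z, z \in rs -> conjc z \in rs) ->
  (forall z, z \in rs -> 1 <= s z /\ normc z <= s z) ->
  (\prod_(z <- rs) ((4 * n.+1 * 2 ^ M)%:R * s z ^+ (M + n))) ^+ T
    * B.+1%:R ^+ (size rs * T) < B.+1%:R ^+ (M * n.+1) :> R ->
  exists g : nat -> {poly int},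
    [/\ forall k, (size (g k) <= n.+1)%N, exists2 k, (k < M)%N & g k != 0,
        forall k j, `|(g k)`_j| <= B%:Z &
        forall i z, (i < T)%N -> z \in rs ->
          normc (map_poly intr (aux_diag M i g)).[z] < 1].
Proof.
move=> rsC rss bound.
pose I := ('I_M * 'I_n.+1)%type; pose J := ('I_T * 'I_(size rs))%type.
pose zj (j : J) := rs`_j.2.
pose w (i : nat) (z : R[i]) (kj : I) := z ^+ (kj.1 - i) * z ^+ kj.2 *+ 'C(kj.1, i).
pose l (j : J) (kj : I) : R := 2%:R * ReIm (zj j) (w j.1 (zj j) kj).
pose c (j : J) : R := (2 * n.+1 * 2 ^ M)%:R * s (zj j) ^+ (M + n).
have zjrs j : zj j \in rs by apply: mem_nth.
have s1 j : 1 <= s (zj j) by case: (rss _ (zjrs j)).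
have lc j : \sum_kj `|l j kj| <= c j.
  have le1 kj : `|l j kj| <= 2%:R * s (zj j) ^+ (M + n) * 'C(kj.1, j.1)%:R.
    rewrite /l normrM ger0_norm // -mulrA ler_wpM2l //.
    apply: le_trans (ReIm_le_normc _ _) _; rewrite /w -mulr_natr normcM normc_nat.
    rewrite ler_wpM2r // -exprD normcX.
    have [_ zs] := rss _ (zjrs j).
    apply: le_trans (_ : s (zj j) ^+ (kj.1 - j.1 + kj.2) <= _).
      by rewrite lerXn2r ?nnegrE ?normc_ge0 // (le_trans _ zs) ?normc_ge0.
    apply: ler_weXn2l => //; apply: leq_add.
      by apply: leq_trans (leq_subr _ _) (ltnW (ltn_ord _)).
    by rewrite -ltnS.
  apply: le_trans (ler_sum _ (fun kj _ => le1 kj)) _.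
  rewrite -(pair_bigA _ (fun (k : 'I_M) (_ : 'I_n.+1) =>
    2%:R * s (zj j) ^+ (M + n) * 'C(k, j.1)%:R)) /=.
  rewrite (eq_bigr (fun k : 'I_M =>
    2%:R * s (zj j) ^+ (M + n) * n.+1%:R * 'C(k, j.1)%:R)); last first.
    by move=> k _; rewrite sumr_const card_ord -mulr_natr; ring.
  rewrite -mulr_sumr /c !natrM.
  have : \sum_(k < M) 'C(k, j.1)%:R <= (2 ^ M)%:R :> R.
    by rewrite -natr_sum ler_nat sum_bin_le.
  have : 0 <= s (zj j) ^+ (M + n) by rewrite exprn_ge0 // (le_trans _ (s1 j)).
  move: (s (zj j) ^+ (M + n)) (\sum_(k < M) _) => S C S0 CM.
  have -> : 2%:R * n.+1%:R * (2 ^ M)%:R * S = 2%:R * S * n.+1%:R * (2 ^ M)%:R.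
    by ring.
  by rewrite ler_wpM2l // !mulr_ge0.
have c1 j : 1 <= c j.
  rewrite mulr_ege1 // ?exprn_ege1 // ler1n !muln_gt0 /= expn_gt0 //.
have [|x [[kj xkj] xB lx]] := @siegel_lemma R I J l c B lc c1.
  have -> : #|{: I}| = (M * n.+1)%N by rewrite card_prod !card_ord.
  apply: le_lt_trans bound.
  have -> : \prod_j (2%:R * c j * B.+1%:R) = \prod_(i < T) \prod_(h < size rs)
      ((4 * n.+1 * 2 ^ M)%:R * s rs`_h ^+ (M + n) * B.+1%:R).
    rewrite pair_bigA; apply: eq_bigr => -[i h] _ /=.
    by rewrite /c /zj /= mulrA -natrM !mulnA.
  rewrite prodr_const card_ord big_split /= prodr_const card_ord exprMn -exprM.
  by rewrite (big_nth 0) big_mkord.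
pose g k : {poly int} := if insub k is Some k' then \poly_(j < n.+1) x (k', inord j) else 0.
have gE (k : 'I_M) : g k = \poly_(j < n.+1) x (k, inord j) by rewrite /g valK.
have g0 k : (M <= k)%N -> g k = 0 by move=> Mk; rewrite /g insubF // ltnNge Mk.
exists g; split.
- move=> k; rewrite /g; case: insub => [k'|]; rewrite ?size_poly0 //; exact: size_poly.
- exists kj.1 => //; apply: contraNneq xkj => e.
  have := congr1 (fun p : {poly int} => p`_kj.2) (gE kj.1).
  by rewrite e coef0 coef_poly ltn_ord inord_val -surjective_pairing => <-.
- move=> k j; rewrite /g; case: insub => [k'|]; rewrite ?coef0 // coef_poly.
  by case: ifP.
have val_lt (i : 'I_T) z : z \in rs ->
    `|2%:R * ReIm z (map_poly intr (aux_diag M i g)).[z]| < 1.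
  move=> zrs; have h : (index z rs < size rs)%N by rewrite index_mem.
  have := lx (i, Ordinal h); rewrite {1}/l /zj /= nth_index //.
  congr (`|_| < 1).
  rewrite rmorph_sum horner_sum /= ReIm_sum mulr_sumr.
  transitivity (\sum_(k < M) \sum_(j < n.+1)
      2%:R * ReIm z (w i z (k, j)) * (x (k, j))%:~R).
    by rewrite pair_bigA; apply: eq_bigr => -[k j] _.
  apply: eq_bigr => k _.
  rewrite rmorphMn rmorphM /= map_polyXn hornerMn hornerM hornerXn gE.
  have -> : map_poly intr (\poly_(j < n.+1) x (k, inord j)) =
      \poly_(j < n.+1) (x (k, inord j))%:~R :> {poly R[i]}.
    by apply/polyP => j; rewrite coef_map !coef_poly; case: ifP.
  rewrite horner_polyn mulr_suml -sumrMnl ReIm_sum mulr_sumr.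
  apply: eq_bigr => j _; rewrite inord_val -mulrA -ReIm_int; congr (_ * ReIm _ _).
  by rewrite /w /=; ring.
move=> i z iT zrs; have vi := val_lt (Ordinal iT).
by apply: normc_lt1_ReIm; [exact: vi|apply: vi; apply: rsC].
Qed.

(** * Evaluation of the auxiliary polynomial *)

Lemma int_norm_ge1 (R : realType) (x : R) : x \is a Num.int -> x != 0 -> 1 <= `|x|.
Proof. by move=> /intrP[m ->]; rewrite intr_eq0 -intr_norm ler1z -gtz0_ge1 normr_gt0. Qed.

(** The first coordinate is the integer [a], so denominators come from [p / q] alone: [q^n] times
    the value is a nonzero integer. *)
Lemma aux_eval_lower (R : realType) (M n i : nat) (g : nat -> {poly int})
    (p q a : int) :
  (forall k, (size (g k) <= n.+1)%N) -> 1 <= q ->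
  (aux_at M g (p%:~R / q%:~R : R))^`N(i).[a%:~R] != 0 ->
  1 <= q%:~R ^+ n * `|(aux_at M g (p%:~R / q%:~R : R))^`N(i).[a%:~R]|.
Proof.
move=> szg q1; set D := _.[_] => D0.
have q0 : q%:~R != 0 :> R by rewrite intr_eq0; apply: contraTneq q1 => ->.
have qn0 : 0 <= q%:~R ^+ n :> R by rewrite exprn_ge0 // ler0z (le_trans _ q1).
rewrite -[X in X * _]ger0_norm // -normrM int_norm_ge1 //; last first.
  by rewrite mulf_neq0 // expf_neq0.
rewrite /D nderivn_aux_at mulr_sumr; apply: rpred_sum => k _.
rewrite mulrnAr rpredMn // mulrA rpredM //; last by rewrite rpredX // intr_int.
rewrite (@horner_coef_wide _ n.+1); last by apply: leq_trans (size_poly _ _) (szg k).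
rewrite mulr_sumr; apply: rpred_sum => j _; rewrite coef_map /= exprMn mulrCA.
have jn : (j <= n)%N by rewrite -ltnS.
rewrite rpredM ?intr_int // mulrCA rpredM ?rpredX ?intr_int //.
by rewrite exprVn -expfB_cond ?(negPf q0) // rpredX ?intr_int.
Qed.

Lemma norm_exp_dist (R : realDomainType) (x y S : R) (k : nat) :
  1 <= S -> `|x| <= S -> `|y| <= S ->
  `|x ^+ k - y ^+ k| <= k%:R * `|x - y| * S ^+ k.
Proof.
move=> S1 xS yS; elim: k => [|k IHk]; first by rewrite !expr0 subrr normr0 !mul0r.
have S0 : 0 <= S by rewrite (le_trans _ S1).
have -> : x ^+ k.+1 - y ^+ k.+1 = x * (x ^+ k - y ^+ k) + (x - y) * y ^+ k.
  by rewrite !exprS; ring.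
have -> : k.+1%:R * `|x - y| * S ^+ k.+1 =
   S * (k%:R * `|x - y| * S ^+ k) + `|x - y| * S ^+ k.+1.
  by rewrite !exprS -natr1; ring.
apply: le_trans (ler_normD _ _) _; rewrite !normrM.
apply: lerD; first by rewrite ler_pM.
rewrite ler_wpM2l // normrX; apply: le_trans (_ : S ^+ k <= _).
  by rewrite lerXn2r ?nnegrE.
by rewrite ler_weXn2l.
Qed.

Lemma aux_coef_sum_le (R : realType) (M i : nat) (c S x : R) (f : nat -> R) :
  0 <= c -> 1 <= S -> `|x| <= S -> (forall k, `|f k| <= c) ->
  `|\sum_(k < M) f k * x ^+ (k - i) *+ 'C(k, i)| <= c * 2%:R ^+ M * S ^+ M.
Proof.
move=> c0 S1 xS fc; apply: le_trans (ler_norm_sum _ _ _) _.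
apply: le_trans (_ : \sum_(k < M) (c * S ^+ M) * 'C(k, i)%:R <= _).
  apply: ler_sum => k _; rewrite -mulr_natr !normrM normr_nat ler_wpM2r //.
  rewrite ler_pM // normrX; apply: le_trans (_ : S ^+ (k - i) <= _).
    by rewrite lerXn2r ?nnegrE // (le_trans _ xS).
  by rewrite ler_weXn2l // (leq_trans (leq_subr _ _)) // ltnW.
rewrite -mulr_sumr [leRHS]mulrAC ler_wpM2l //.
  by rewrite mulr_ge0 // exprn_ge0 // (le_trans _ S1).
by rewrite -natr_sum -natrX ler_nat sum_bin_le.
Qed.

Lemma aux_eval_dist (R : realType) (M n i B : nat) (g : nat -> {poly int})
    (x y a S : R) :
  (forall k, (size (g k) <= n.+1)%N) -> (forall k j, `|(g k)`_j| <= B%:Z) ->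
  1 <= S -> `|x| <= S -> `|y| <= S -> `|a| <= S ->
  `|(aux_at M g x)^`N(i).[a] - (aux_at M g y)^`N(i).[a]| <=
  (B * (n.+1 * n))%:R * 2%:R ^+ M * S ^+ (M + n) * `|x - y|.
Proof.
move=> szg gB S1 xS yS aS; rewrite !nderivn_aux_at -sumrB.
rewrite (eq_bigr (fun k : 'I_M =>
   ((map_poly intr (g k)).[x] - (map_poly intr (g k)).[y]) * a ^+ (k - i) *+ 'C(k, i)));
  last by move=> k _; rewrite -mulrnBl -mulrBl.
apply: le_trans (_ : ((B * (n.+1 * n))%:R * S ^+ n * `|x - y|) * 2%:R ^+ M * S ^+ M <= _).
  apply: (@aux_coef_sum_le _ _ _ _ _ _ (fun k =>
    (map_poly intr (g k)).[x] - (map_poly intr (g k)).[y])) => //.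
    by rewrite !mulr_ge0 // exprn_ge0 // (le_trans _ S1).
  move=> k; rewrite !(@horner_coef_wide _ n.+1); first last.
  - by apply: leq_trans (size_poly _ _) (szg k).
  - by apply: leq_trans (size_poly _ _) (szg k).
  rewrite -sumrB; apply: le_trans (ler_norm_sum _ _ _) _.
  apply: le_trans (_ : \sum_(j < n.+1) B%:R * (n%:R * `|x - y| * S ^+ n) <= _).
    apply: ler_sum => j _; rewrite -mulrBr normrM coef_map /= -intr_norm.
    apply: ler_pM => //.
      by rewrite pmulrn ler_int.
    apply: le_trans (norm_exp_dist j S1 xS yS) _.
    have jn : (j <= n)%N by rewrite -ltnS.
    rewrite !ler_pM ?mulr_ge0 ?exprn_ge0 ?ler_nat ?ler_weXn2l //.
    by rewrite (le_trans _ S1).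
  rewrite sumr_const card_ord -mulr_natr !natrM le_eqVlt; apply/orP; left.
  by apply/eqP; ring.
by rewrite exprD le_eqVlt; apply/orP; left; apply/eqP; ring.
Qed.

(** In the Taylor expansion at [x] the terms with [i + m < T] vanish. The base 8 is 2 for the sum of
    binomials in a diagonal value, 2 for ['C(i + m, i)] with [i + m < M], and 2 for the number
    [M <= 2^M] of terms. *)
Lemma aux_eval_diag_le (R : realType) (M n i B T : nat) (g : nat -> {poly int})
    (x a S : R) :
  (forall k, (size (g k) <= n.+1)%N) -> (forall k j, `|(g k)`_j| <= B%:Z) ->
  (forall m, (m < T)%N -> root (map_poly intr (aux_diag M m g)) x) ->
  1 <= S -> `|x| <= S -> `|a - x| <= 1 ->
  `|(aux_at M g x)^`N(i).[a]| <=
  (B * n.+1)%:R * 8%:R ^+ M * S ^+ (M + n) * `|a - x| ^+ (T - i).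
Proof.
move=> szg gB vg S1 xS ax.
have S0 : 0 <= S by rewrite (le_trans _ S1).
rewrite (@nderivn_taylor_at _ _ x _ _ M) ?size_poly //.
have Dle m : `|(aux_at M g x)^`N(m).[x]| <= (B * n.+1)%:R * 2%:R ^+ M * S ^+ (M + n).
  rewrite nderivn_aux_at.
  apply: le_trans (_ : ((B * n.+1)%:R * S ^+ n) * 2%:R ^+ M * S ^+ M <= _); last first.
    by rewrite exprD le_eqVlt; apply/orP; left; apply/eqP; ring.
  apply: (@aux_coef_sum_le _ _ _ _ _ _ (fun k => (map_poly intr (g k)).[x])) => //.
    by rewrite mulr_ge0 // exprn_ge0.
  move=> k; rewrite (@horner_coef_wide _ n.+1); last first.
    by apply: leq_trans (size_poly _ _) (szg k).
  apply: le_trans (ler_norm_sum _ _ _) _.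
  apply: le_trans (_ : \sum_(j < n.+1) B%:R * S ^+ n <= _).
    apply: ler_sum => j _; rewrite normrM coef_map /= -intr_norm normrX.
    apply: ler_pM => //; rewrite ?ler0z ?exprn_ge0 //.
      by rewrite pmulrn ler_int.
    apply: le_trans (_ : S ^+ j <= _); first by rewrite lerXn2r ?nnegrE.
    by rewrite ler_weXn2l // -ltnS.
  rewrite sumr_const card_ord -mulr_natr !natrM le_eqVlt; apply/orP; left.
  by apply/eqP; ring.
set E := (B * n.+1)%:R * 2%:R ^+ M * S ^+ (M + n) in Dle.
have E0 : 0 <= E by apply: le_trans (Dle 0%N).
apply: le_trans (ler_norm_sum _ _ _) _.
apply: le_trans (_ : \sum_(m < M) E * `|a - x| ^+ (T - i) * 2%:R ^+ M <= _); last first.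
  rewrite sumr_const card_ord -[_ *+ M]mulr_natr.
  have M2 : M%:R <= 2%:R ^+ M :> R by rewrite -natrX ler_nat ltnW // ltn_expl.
  apply: le_trans (_ : E * `|a - x| ^+ (T - i) * 2%:R ^+ M * 2%:R ^+ M <= _).
    by rewrite ler_wpM2l // !mulr_ge0 // exprn_ge0.
  have -> : 8%:R = 2%:R * 2%:R * 2%:R :> R by rewrite -!natrM.
  by rewrite /E !exprMn le_eqVlt; apply/orP; left; apply/eqP; ring.
apply: ler_sum => m _; rewrite -mulr_natr !normrM normr_nat.
have [imT|Tim] := ltnP (i + m) T.
  rewrite nderivn_aux_at_diag (rootP (vg _ imT)) normr0 !mul0r.
  by rewrite !mulr_ge0 // ?exprn_ge0.
have [Mim|imM] := leqP M (i + m).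
  rewrite nderivn_poly0 ?horner0 ?normr0 ?mul0r; last by apply: leq_trans (size_poly _ _) Mim.
  by rewrite !mulr_ge0 // ?exprn_ge0.
apply: ler_pM; rewrite ?mulr_ge0 //.
  apply: ler_pM => //; rewrite normrX; apply: ler_wiXn2l => //.
  by rewrite leq_subLR.
rewrite -natrX ler_nat; apply: leq_trans (_ : 2 ^ (i + m) <= _)%N.
  rewrite -[2%N]/(1 + 1)%N expnDn (bigD1 (Ordinal (leq_addr m i : (i < (i + m).+1)%N))) //=.
  by rewrite !exp1n !muln1 leq_addr.
by rewrite leq_exp2l // ltnW.
Qed.

(** * The exponent *)

(** Consecutive convergents of the continued fraction; the preceding upper one, [99 / 70], is too
    coarse for the bound [181 / 10] used below. *)
Lemma sqrt2_bounds (R : realFieldType) (w : R) : 0 < w -> w ^+ 2 = 2%:R ->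
  1393%:R / 985%:R < w < 577%:R / 408%:R.
Proof. by move=> w0 w2; apply/andP; split; nra. Qed.

(* [w] stands for the square root of 2 and [x] for [d0]. *)
Definition gain_ratio (R : realFieldType) (w x u : R) : R :=
  (3%:R - 2%:R * w) * ((u - x - 1) / (u + w - 1)).

(** This says that the exponent is below [dhat], with the denominator cleared. With
    [c = 11 (3 - 2 sqrt 2)], about 1.887, [11 f(dhat)] stays above 1 as [d0] grows only if the slope
    of [dhat] is at least [c / (c - 1)], about 2.127: hence 2.13. The constant 23 is the least
    integer that serves [d0 = 0]. *)
Lemma gain_ratio_dhat (R : realFieldType) (w x u : R) :
  0 < w -> w ^+ 2 = 2%:R -> 0 <= x -> u = 213%:R / 100%:R * x + 23%:R ->
  1 < (11%:R * gain_ratio w x u - 1) * (u / 10%:R - 1).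
Proof.
move=> w_gt0 w_sqr x_ge0 uE.
have /andP[w1 w2] := sqrt2_bounds w_gt0 w_sqr.
have den0 : 0 < u + w - 1 by lra.
have -> : (11%:R * gain_ratio w x u - 1) * (u / 10%:R - 1) =
   ((11%:R * (3%:R - 2%:R * w) * (u - x - 1) - (u + w - 1)) *
    (u / 10%:R - 1)) / (u + w - 1).
  by rewrite /gain_ratio; field; apply: lt0r_neq0.
rewrite ltr_pdivlMr // mul1r.
have num : 181%:R / 10%:R <=
    11%:R * (3%:R - 2%:R * w) * (u - x - 1) - (u + w - 1).
  by rewrite uE; nra.
have e0 : 0 <= u / 10%:R - 1 by lra.
by apply: lt_le_trans (ler_wpM2r e0 num); rewrite uE; lra.
Qed.

Lemma gain_ratio_dhat_gt (R : realFieldType) (w x u : R) :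
  0 < w -> w ^+ 2 = 2%:R -> 0 <= x -> u = 213%:R / 100%:R * x + 23%:R ->
  0 < 11%:R * gain_ratio w x u - 1.
Proof.
move=> w0 w2 x0 uE; have := gain_ratio_dhat w0 w2 x0 uE.
have u0 : 0 < u / 10%:R - 1 by lra.
by move=> /(lt_trans ltr01); rewrite pmulr_lgt0.
Qed.

Lemma gain_ratio_mono (R : realFieldType) (w x u v : R) :
  0 < w -> w ^+ 2 = 2%:R -> 0 <= x -> 213%:R / 100%:R * x + 23%:R <= u -> u <= v ->
  gain_ratio w x u <= gain_ratio w x v.
Proof.
move=> w0 ww x0 du uv; have /andP[w1 w2] := sqrt2_bounds w0 ww.
rewrite /gain_ratio ler_wpM2l //; first by lra.
rewrite ler_pdivrMr; last by lra.
rewrite mulrAC ler_pdivlMr; last by lra.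
have : 0 <= (v - u) * (w + x) by rewrite mulr_ge0; lra.
by nra.
Qed.

Lemma exponent_lt_dhat (R : realFieldType) (w x u : R) :
  0 < w -> w ^+ 2 = 2%:R -> 0 <= x -> u = 213%:R / 100%:R * x + 23%:R ->
  10%:R * (1 + 1 / (11%:R * gain_ratio w x u - 1)) < u.
Proof.
move=> w0 w2 x0 uE; have F0 := gain_ratio_dhat_gt w0 w2 x0 uE.
have := gain_ratio_dhat w0 w2 x0 uE.
move: (11%:R * gain_ratio w x u - 1) F0 => F F0.
by rewrite mulrC -ltr_pdivrMr // => h; lra.
Qed.

Lemma exponent_le_dhat (R : realFieldType) (w x u v : R) :
  0 < w -> w ^+ 2 = 2%:R -> 0 <= x -> u = 213%:R / 100%:R * x + 23%:R -> u <= v ->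
  10%:R * (1 + 1 / (11%:R * gain_ratio w x v - 1)) <=
  10%:R * (1 + 1 / (11%:R * gain_ratio w x u - 1)).
Proof.
move=> w0 w2 x0 uE uv; have F0 := gain_ratio_dhat_gt w0 w2 x0 uE.
have := gain_ratio_mono w0 w2 x0 _ uv; rewrite -uE lexx => /(_ isT) fu.
by rewrite ler_pM2l ?ltr0n // lerD2l !div1r lef_pV2 ?posrE //; lra.
Qed.

(* [Phi] is the cost per unit of [x]-degree of the auxiliary polynomial, and
   [Delta] the gain per order of vanishing. *)
Lemma gain_dominates_cost (R : realFieldType) (w x d eta Lam r l tau : R) :
  let f := gain_ratio w x d in
  let kappa := 10%:R * (1 + 1 / (11%:R * f - 1)) + eta in
  let Phi := (w + 2%:R) * Lam + ((w + 1) * (d + 1) + 4%:R) * tau + (w + 1) * (d - 1) * r in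
  let Delta := (d - 1 - x) * Lam - l - 2%:R * d * tau in
  0 < w -> w ^+ 2 = 2%:R -> 0 <= x -> 23%:R <= d -> 0 < 11%:R * f - 1 -> 0 < eta ->
  0 <= r -> 0 <= l -> 0 <= tau ->
  kappa * (2%:R * d * tau + d * r + 2%:R * l) <= eta * (11%:R * f - 1) * Lam ->
  kappa * ((d + w - 1) / 11%:R * Phi) <= (kappa - 10%:R) * (2%:R - w) * Delta.
Proof.
move=> f kappa Phi Delta w0 w2 x0 d23 F0 eta0 r0 l0 tau0 H.
have /andP[w1 w1'] := sqrt2_bounds w0 w2.
have bw : 0 < 2%:R - w by clear -w1'; lra.
have bd : 0 < d + w - 1 by clear -w1 d23; lra.
have bd23 : 23%:R <= d + w - 1 by clear -w1 d23; lra.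
have w20 : 0 < w + 2%:R by clear -w0; lra.
have d0 : 0 <= d by clear -d23; lra.
pose F := 11%:R * f - 1.
have kF : kappa * F = 10%:R * (F + 1) + eta * F.
  by rewrite /kappa -/F; field; apply: lt0r_neq0.
have k10 : 10%:R <= kappa.
  have : 0 < 1 / F by rewrite divr_gt0.
  by rewrite /kappa -/F; clear -eta0; lra.
pose W := 2%:R * d * tau + d * r + 2%:R * l.
pose phi := ((w + 1) * (d + 1) + 4%:R) * tau + (w + 1) * (d - 1) * r.
pose psi := l + 2%:R * d * tau.
pose D := (d + w - 1) * (w + 2%:R) / 11%:R.
have D0 : 0 < D by rewrite /D divr_gt0 // mulr_gt0.
(* The coefficients of [Lam] in gain and cost have ratio [F + 1 = 11 f], because
   [(3 - 2 w) (w + 2) = 2 - w]. *)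
have fD : (2%:R - w) * (d - 1 - x) = (F + 1) * D.
  have -> : F + 1 = 11%:R * f by rewrite /F; ring.
  have dn0 : d + w - 1 != 0 by exact: lt0r_neq0.
  have -> : 11%:R * f * D = (3%:R - 2%:R * w) * (w + 2%:R) * (d - x - 1).
    by rewrite /f /gain_ratio /D; field.
  have -> : (3%:R - 2%:R * w) * (w + 2%:R) = 2%:R - w.
    have -> : (3%:R - 2%:R * w) * (w + 2%:R) = 6%:R - w - 2%:R * w ^+ 2 by ring.
    by rewrite w2; ring.
  by ring.
have psi0 : 0 <= psi by rewrite /psi addr_ge0 // !mulr_ge0.
(* The terms other than [Lam], of cost and gain together, fit into [D W]; in the application [W] is
   the logarithm of the base of the power in [a0]. *)
have key : (d + w - 1) / 11%:R * phi + (2%:R - w) * psi <= D * W.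
  have e : (w + 2%:R) * W - phi = ((w + 3%:R) * d - w - 5%:R) * tau
      + (d + w + 1) * r + 2%:R * (w + 2%:R) * l.
    by rewrite /W /phi; ring.
  have wd : 1393%:R / 985%:R * d <= w * d by rewrite ler_wpM2r // ltW.
  have tl : 0 <= w * tau by rewrite mulr_ge0 // ltW.
  have dr : 0 <= (d + w + 1) * r by rewrite mulr_ge0 //; clear -w0 d0; lra.
  have wl : 0 <= w * l by rewrite mulr_ge0 // ltW.
  have dt : 23%:R * tau <= d * tau by rewrite ler_wpM2r.
  have wdt : 1393%:R / 985%:R * (d * tau) <= w * (d * tau).
    by rewrite ler_wpM2r ?mulr_ge0 // ltW.
  have wt : w * tau <= 577%:R / 408%:R * tau by rewrite ler_wpM2r // ltW.
  have low : 11%:R * ((2%:R - w) * psi) <= 23%:R * ((w + 2%:R) * W - phi).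
    have -> : 11%:R * ((2%:R - w) * psi) =
        22%:R * l + 44%:R * (d * tau) - 11%:R * (w * l) - 22%:R * (w * (d * tau)).
      by rewrite /psi; ring.
    have -> : 23%:R * ((w + 2%:R) * W - phi) =
        23%:R * (w * (d * tau)) + 69%:R * (d * tau) - 23%:R * (w * tau) - 115%:R * tau
        + 23%:R * ((d + w + 1) * r) + 46%:R * (w * l) + 92%:R * l.
      by rewrite e; ring.
    by clear -wl dt wdt wt dr l0 tau0; lra.
  have W0 : 0 <= (w + 2%:R) * W - phi.
    have : 0 <= (2%:R - w) * psi by rewrite mulr_ge0 // ltW.
    by move=> p0; clear -p0 low; lra.
  have mid : 23%:R * ((w + 2%:R) * W - phi) <= (d + w - 1) * ((w + 2%:R) * W - phi).
    by rewrite ler_wpM2r.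
  have -> : D * W = (d + w - 1) / 11%:R * phi +
      (d + w - 1) * ((w + 2%:R) * W - phi) / 11%:R by rewrite /D; field.
  by rewrite lerD2l ler_pdivlMr // mulrC; apply: le_trans low mid.
have e1 : (d + w - 1) / 11%:R * Phi = D * Lam + (d + w - 1) / 11%:R * phi.
  by rewrite /Phi /D /phi; field.
have e2 : (2%:R - w) * Delta = (F + 1) * D * Lam - (2%:R - w) * psi.
  by rewrite -fD /Delta /psi; ring.
rewrite e1 -[(kappa - 10%:R) * _ * _]mulrA e2 mulrDr mulrBr.
have h1 : kappa * W * D <= eta * F * Lam * D by rewrite ler_wpM2r // ltW.
have k0 : 0 <= kappa by clear -k10; lra.
have h2 : (kappa - 10%:R) * ((F + 1) * D * Lam) - kappa * (D * Lam) = eta * F * Lam * D.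
  have -> : (kappa - 10%:R) * ((F + 1) * D * Lam) - kappa * (D * Lam) =
    (kappa * F - 10%:R * (F + 1)) * (D * Lam) by ring.
  by rewrite kF; ring.
have h3 : kappa * ((d + w - 1) / 11%:R * phi + (2%:R - w) * psi) <= kappa * (D * W).
  by rewrite ler_wpM2l.
have h4 : (kappa - 10%:R) * ((2%:R - w) * psi) <= kappa * ((2%:R - w) * psi).
  rewrite ler_wpM2r ?mulr_ge0 ?(ltW bw) //; clear; lra.
by rewrite mulrDr in h3; clear -h1 h2 h3 h4; lra.
Qed.

(** The left side will bound the logarithm of [2 q^10 Z], less its part in [q]; it is compared with
    that of [C] separately in [Lam], [tau] and [r]. Here [kappa / 10 <= 2.3 e] and
    [kappa / 10 - 1 <= 1.3 e]; the [Delta] term brings at most [13 e d^2 Lam], whence 14, while 42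
    and 5 leave ample room. *)
Lemma constant_dominates (R : realFieldType) (w x d eta Lam r tau kappa Delta : R) :
  let Phi := (w + 2%:R) * Lam + ((w + 1) * (d + 1) + 4%:R) * tau + (w + 1) * (d - 1) * r in
  let K := 10%:R * (w + 2%:R) * Lam + (6%:R * (w + 1) * d + 10%:R * (w + 1) + 17%:R) * tau
    + 10%:R * (w + 1) * (d - 1) * r in
  let e := x + eta + 1 in
  0 < w -> w ^+ 2 = 2%:R -> 0 <= x -> 23%:R <= d -> 0 < eta ->
  10%:R <= kappa -> kappa <= 213%:R / 100%:R * x + 23%:R + eta ->
  0 <= Lam -> 0 <= r -> 0 <= tau -> 0 <= Delta -> Delta <= (d - 1) * Lam ->
  kappa / 10%:R * (tau + Phi + K) + (d + w - 1) / 11%:R * Phi +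
    (kappa / 10%:R - 1) * ((10%:R * d + 10%:R) * Delta) <=
  42%:R * e * d ^+ 2 * tau + 5%:R * e * d ^+ 2 * r + 14%:R * e * d ^+ 2 * Lam.
Proof.
move=> Phi K e w0 w2 x0 d23 eta0 k10 kx Lam0 r0 tau0 Delta0 DeltaL.
have /andP[w1 w1'] := sqrt2_bounds w0 w2.
have {}w1 : 0 <= w by exact: ltW.
have {}w1' : w <= 17%:R / 12%:R by clear -w1'; lra.
pose X := kappa / 10%:R.
have e1 : 1 <= e by rewrite /e; clear -x0 eta0; lra.
have X1 : 1 <= X by rewrite /X; clear -k10; lra.
have Xe : X <= 23%:R / 10%:R * e by rewrite /X /e; clear -kx x0 eta0; lra.
have Xe1 : X - 1 <= 13%:R / 10%:R * e by rewrite /X /e; clear -kx x0 eta0; lra.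
have {kx k10} X0 : 0 <= X by clear -X1; lra.
have X10 : 0 <= X - 1 by clear -X1; lra.
have e0 : 0 <= e by clear -e1; lra.
have dd : 23%:R * d <= d ^+ 2 by rewrite expr2 ler_wpM2r //; clear -d23; lra.
have d0 : 0 <= d by clear -d23; lra.
have d1 : 0 <= d - 1 by clear -d23; lra.
have wd0 : 0 <= (d + w - 1) / 11%:R by rewrite divr_ge0 //; clear -d23 w1; lra.
have wd : (d + w - 1) / 11%:R <= (d + 5%:R / 12%:R) / 11%:R.
  by rewrite ler_pM2r ?invr_gt0 //; clear -w1'; lra.
have scale (A C p q s : R) : 0 <= p -> 0 <= q -> 0 <= s ->
    X * A <= 23%:R / 10%:R * e * p -> C <= e * q ->
    23%:R / 10%:R * p + q <= s -> X * A + C <= s * e.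
  move=> p0 q0 s0 XA Cq pqs.
  have : e * (23%:R / 10%:R * p + q) <= e * s by rewrite ler_wpM2l.
  by rewrite mulrDr; move: XA Cq; clear; lra.
have Xle (A p : R) : 0 <= A -> A <= p -> X * A <= 23%:R / 10%:R * e * p.
  by move=> A0 Ap; rewrite ler_pM.
have ele (C q : R) : 0 <= q -> C <= q -> C <= e * q.
  by move=> q0 Cq; apply: le_trans Cq _; rewrite ler_peMl.
have wd1 : w * d <= 17%:R / 12%:R * d by rewrite ler_wpM2r.
have wd10 : 0 <= w * d by rewrite mulr_ge0.
have hLam : X * (11%:R * (w + 2%:R)) + ((d + w - 1) / 11%:R * (w + 2%:R) +
    (X - 1) * ((10%:R * d + 10%:R) * (d - 1))) <= 14%:R * d ^+ 2 * e.
  apply: (@scale _ _ (11%:R * (41%:R / 12%:R))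
    ((d + 5%:R / 12%:R) / 11%:R * (41%:R / 12%:R) + 13%:R * (d ^+ 2 - 1))).
  - by rewrite mulr_ge0 // divr_ge0.
  - by rewrite addr_ge0 // ?mulr_ge0 //; clear -dd d23; lra.
  - by rewrite mulr_ge0 // sqr_ge0.
  - by apply: Xle; clear -w1 w1'; lra.
  - rewrite [leRHS]mulrDr lerD //.
      apply: ele; first by rewrite !mulr_ge0 //; clear -d0; lra.
      by rewrite ler_pM //; clear -w1 w1'; lra.
    apply: le_trans (_ : 13%:R / 10%:R * e * ((10%:R * d + 10%:R) * (d - 1)) <= _).
      by rewrite ler_wpM2r // mulr_ge0 //; clear -d0; lra.
    by rewrite le_eqVlt; apply/orP; left; apply/eqP; field.
  by clear -dd d23; rewrite !expr2 in dd *; lra.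
have htau : X * (7%:R * (w + 1) * d + 11%:R * (w + 1) + 22%:R) +
    (d + w - 1) / 11%:R * ((w + 1) * (d + 1) + 4%:R) <= 42%:R * d ^+ 2 * e.
  apply: (@scale _ _ (17%:R * d + 49%:R)
    ((d + 5%:R / 12%:R) / 11%:R * (29%:R / 12%:R * (d + 1) + 4%:R))).
  - by clear -d0; lra.
  - by rewrite !mulr_ge0 //; clear -d0; lra.
  - by rewrite mulr_ge0 // sqr_ge0.
  - by apply: Xle; clear -w1 w1' wd1 d0 wd10; lra.
  - apply: ele; first by rewrite !mulr_ge0 //; clear -d0; lra.
    by rewrite ler_pM //; clear -w1 w1' wd1 d0 wd10; lra.
  by clear -dd d23; rewrite !expr2 in dd *; lra.
have wv1 : w * (d - 1) <= 17%:R / 12%:R * (d - 1) by rewrite ler_wpM2r.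
have wv0 : 0 <= w * (d - 1) by rewrite mulr_ge0.
have hr : X * (11%:R * (w + 1) * (d - 1)) +
    (d + w - 1) / 11%:R * ((w + 1) * (d - 1)) <= 5%:R * d ^+ 2 * e.
  apply: (@scale _ _ (11%:R * (29%:R / 12%:R) * (d - 1))
    ((d + 5%:R / 12%:R) / 11%:R * (29%:R / 12%:R * (d - 1)))).
  - by clear -d1; lra.
  - by rewrite !mulr_ge0 //; clear -d0; lra.
  - by rewrite mulr_ge0 // sqr_ge0.
  - by apply: Xle; clear -wv1 wv0 d1; lra.
  - apply: ele; first by rewrite !mulr_ge0 //; clear -d0; lra.
    by rewrite ler_pM //; clear -wv1 wv0 d1; lra.
  by clear -dd d23; rewrite !expr2 in dd *; lra.
have hD : (X - 1) * ((10%:R * d + 10%:R) * Delta) <=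
    (X - 1) * ((10%:R * d + 10%:R) * ((d - 1) * Lam)).
  by rewrite !ler_wpM2l //; clear -d0; lra.
have hLam' := ler_wpM2r Lam0 hLam; have htau' := ler_wpM2r tau0 htau.
have hr' := ler_wpM2r r0 hr.
have -> : X * (tau + Phi + K) + (d + w - 1) / 11%:R * Phi =
  (X * (11%:R * (w + 2%:R)) + (d + w - 1) / 11%:R * (w + 2%:R)) * Lam +
  (X * (7%:R * (w + 1) * d + 11%:R * (w + 1) + 22%:R) +
    (d + w - 1) / 11%:R * ((w + 1) * (d + 1) + 4%:R)) * tau +
  (X * (11%:R * (w + 1) * (d - 1)) +
    (d + w - 1) / 11%:R * ((w + 1) * (d - 1))) * r.
  by rewrite /Phi /K; field.
rewrite -/X; move: hD hLam' htau' hr'; clear; lra.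
Qed.

(** * Choice of the parameters *)

Lemma powR_expR (R : realType) (x y : R) : 0 < x -> x `^ y = expR (y * ln x).
Proof. by move=> x0; rewrite /powR gt_eqF. Qed.

(* The choice of the order of vanishing [T], the [x]-degree [M - 1] and the
   height [B] of the auxiliary polynomial. *)
Lemma thue_parameters (R : realType) (d0 d : nat) (w a rho1 L eta q kappa : R) :
  0 < w -> w ^+ 2 = 2%:R -> (23 <= d)%N -> (d0 < d)%N -> 0 < 11%:R * gain_ratio w d0%:R d%:R - 1 ->
  1 < a -> 1 <= rho1 -> 1 <= L -> 1 <= q -> 0 < eta ->
  kappa = 10%:R * (1 + 1 / (11%:R * gain_ratio w d0%:R d%:R - 1)) + eta ->
  kappa <= 213%:R / 100%:R * d0%:R + 23%:R + eta ->
  kappa * (2%:R * d%:R * ln 2%:R + d%:R * ln rho1 + 2%:R * ln L) <=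
    eta * (11%:R * gain_ratio w d0%:R d%:R - 1) * ln a ->
  exists T M B : nat,
    let Z := (B * 110)%:R * 8%:R ^+ M * (2%:R * a) ^+ (M + 10) in
    [/\ ((44 * 2 ^ M)%:R ^+ d * (2%:R * a) ^+ (M + 10) * rho1 ^+ ((M + 10) * d.-1)) ^+ T
        * B.+1%:R ^+ (d * T) < B.+1%:R ^+ (M * 11),
      forall (i : nat) (delta : R), (i + d * (T - 10) <= 11 * M.-1 + 10)%N ->
        0 <= delta -> delta <= L * 2%:R ^+ (2 * d) / a ^+ (d - 1 - d0) ->
        2%:R * (q ^+ 10 * (Z * delta ^+ (T - i))) <= 1 &
      2%:R * (q ^+ 10 * Z) <=
        2%:R `^ (42%:R * (d0%:R + eta + 1) * d%:R ^+ 2)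
        * rho1 `^ (5%:R * (d0%:R + eta + 1) * d%:R ^+ 2)
        * a `^ (14%:R * (d0%:R + eta + 1) * d%:R ^+ 2) * q `^ kappa].
Proof.
set x := d0%:R; set D := d%:R; set f := gain_ratio w x D.
set Lam := ln a; set r := ln rho1; set l := ln L; set tau := ln 2%:R.
set C := _ * _ `^ (14%:R * _ * _).
move=> w0 w2 d23 d0d F0 a1 rho1_ge1 L1 q1 eta0 kE kle H1.
have /andP[w1 w1'] := sqrt2_bounds w0 w2.
pose Lq := ln q.
have Lam0 : 0 < Lam by apply: ln_gt0.
have r0 : 0 <= r by apply: ln_ge0.
have l0 : 0 <= l by apply: ln_ge0.
have tau0 : 0 <= tau by apply: ln_ge0; rewrite ler1n.
have Lq0 : 0 <= Lq by apply: ln_ge0.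
have x0 : 0 <= x by apply: ler0n.
have D23 : 23%:R <= D by rewrite ler_nat.
have a0 : 0 < a by apply: lt_trans a1.
have rho0 : 0 < rho1 by apply: lt_le_trans rho1_ge1.
have L0 : 0 < L by apply: lt_le_trans L1.
have q0 : 0 < q by apply: lt_le_trans q1.
pose Phi := (w + 2%:R) * Lam + ((w + 1) * (D + 1) + 4%:R) * tau + (w + 1) * (D - 1) * r.
pose K := 10%:R * (w + 2%:R) * Lam + (6%:R * (w + 1) * D + 10%:R * (w + 1) + 17%:R) * tau
    + 10%:R * (w + 1) * (D - 1) * r.
pose Delta := (D - 1 - x) * Lam - l - 2%:R * D * tau.
pose h := (D + w - 1) / 11%:R * Phi.
have gain : kappa * h <= (kappa - 10%:R) * (2%:R - w) * Delta.
  by rewrite kE; apply: gain_dominates_cost => //; rewrite -kE.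
have k10 : 10%:R < kappa.
  rewrite kE; have : 0 < 1 / (11%:R * f - 1) by rewrite divr_gt0.
  by clear -eta0; lra.
have Phi0 : 0 < Phi.
  rewrite /Phi -addrA ltr_pwDl ?mulr_gt0 ?addr_gt0 //.
  by rewrite addr_ge0 // !mulr_ge0 //; clear -w0 D23; nra.
have h0 : 0 < h by rewrite /h mulr_gt0 // divr_gt0 //; clear -w1 D23; lra.
have K0 : 0 <= K.
  by rewrite /K !addr_ge0 // !mulr_ge0 //; clear -w0 D23 Lam0; nra.
have w2' : 0 < 2%:R - w by clear -w1'; lra.
have Delta0 : 0 < Delta.
  have : 0 < (kappa - 10%:R) * (2%:R - w) * Delta.
    by apply: lt_le_trans gain; rewrite mulr_gt0 //; clear -k10; lra.
  by rewrite pmulr_rgt0 // mulr_gt0 //; clear -k10; lra.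
(* Net gain in the logarithm per unit of [T]. *)
pose g := (2%:R - w) * Delta - h.
have kg : 10%:R * ((2%:R - w) * Delta) <= kappa * g.
  by rewrite /g; move: gain; clear; lra.
have g0 : 0 < g.
  have : 0 < kappa * g by apply: lt_le_trans kg; rewrite !mulr_gt0.
  by rewrite pmulr_rgt0 //; clear -k10; lra.
(* Losses that do not grow with [T]: [Phi] from rounding [M] up, [K] from the constants in [Z],
   [tau] from the factor 2, the last term from the shift in the bound on [i]. *)
pose S0 := Phi + K + tau + Delta * (10%:R * D + 10%:R).
have S0g : 0 <= (S0 + 10%:R * Lq) / g.
  rewrite divr_ge0 ?(ltW g0) // addr_ge0 //; last by rewrite mulr_ge0.
  have : 0 <= Delta * (10%:R * D + 10%:R).
    by rewrite mulr_ge0 ?(ltW Delta0) //; clear -D23; lra.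
  by move: (ltW Phi0) K0 tau0; rewrite /S0; clear; lra.
pose T := (Num.truncn ((S0 + 10%:R * Lq) / g)).+1.
have [T1 T2] : S0 + 10%:R * Lq <= T%:R * g /\ T%:R * h <= (S0 + 10%:R * Lq) / g * h + h.
  have /andP[lo hi] := truncn_itv S0g; split.
    by rewrite -ler_pdivrMr // ltW.
  have -> : (S0 + 10%:R * Lq) / g * h + h = ((S0 + 10%:R * Lq) / g + 1) * h by ring.
  by rewrite ler_pM2r // /T -natr1 lerD2r.
have T0 : 0 < T%:R :> R by rewrite ltr0n.
pose mu := (D + w - 1) / 11%:R * T%:R.
have mu0 : 0 <= mu.
  by rewrite /mu mulr_ge0 // divr_ge0 //; clear -w1 D23; lra.
pose M := (Num.truncn mu).+1.
have [M1 M2] : mu <= M%:R /\ M%:R <= mu + 1.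
  have /andP[lo hi] := truncn_itv mu0; split; first exact: ltW.
  by rewrite /M -natr1 lerD2r.
(* Bounds the logarithm of what one order of vanishing costs in Siegel's lemma; the 6 comes from
   [44 <= 2^6]. *)
pose lnY := D * (6%:R + M%:R) * tau + (M%:R + 10%:R) * (tau + Lam + (D - 1) * r).
have lnY0 : 0 <= lnY.
  have M0 : 0 <= M%:R :> R by [].
  have D0 : 0 <= D - 1 by clear -D23; lra.
  by rewrite /lnY addr_ge0 ?mulr_ge0 ?addr_ge0 ?mulr_ge0 // ltW.
(* The slack [11 M - d T >= (w - 1) T] asks for a height of about [expR (lnY / (w - 1))], and
   [1 / (w - 1) = w + 1]. *)
pose B := Num.truncn (expR ((w + 1) * lnY)).
have /andP[B1 B2] := truncn_itv (expR_ge0 ((w + 1) * lnY)).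
rewrite -/B in B1 B2.
exists T, M, B => Z.
have dT : (2%:R - w) * T%:R - 10%:R * D - 10%:R >= 0.
  have : Delta * (10%:R * D + 10%:R) <= Delta * ((2%:R - w) * T%:R).
    have : T%:R * g <= Delta * ((2%:R - w) * T%:R).
      have : 0 <= T%:R * h by rewrite mulr_ge0 // ltW.
      by rewrite /g; clear; lra.
    move: T1 (ltW Phi0) K0 tau0 Lq0; rewrite /S0; clear; lra.
  by rewrite ler_pM2l //; clear; lra.
have T10 : (10 <= T)%N.
  rewrite -(ler_nat R).
  have : 0 <= (w - 1) * T%:R by rewrite mulr_ge0 //; clear -w1; lra.
  by move: dT D23; clear; lra.
have a2ge0 : 0 <= 2%:R * a by rewrite mulr_ge0 // ltW.
have rge0 : 0 <= rho1 by rewrite ltW.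
have tau2 : expR tau = 2%:R by rewrite /tau lnK // posrE.
(* With [110 <= 2^7] and [B <= expR ((w + 1) lnY)], the logarithm splits into [M] times [Phi] and
   the constant [K]. *)
have le_Z : Z <= expR (M%:R * Phi + K).
  have -> : M%:R * Phi + K = (w + 1) * lnY + 7%:R * tau + (3 * M)%:R * tau
      + (M + 10)%:R * (tau + Lam).
    by rewrite /Phi /K /lnY natrM natrD; ring.
  have e3 : expR ((3 * M)%:R * tau) = 8%:R ^+ M.
    rewrite expRM_natl tau2 exprM; congr (_ ^+ _).
    by ring.
  rewrite 3!expRD e3 !expRM_natl expRD tau2 lnK ?posrE //.
  rewrite /Z natrM !ler_pM ?mulr_ge0 ?exprn_ge0 ?expR_ge0 //.
  by rewrite -natrX ler_nat.
have le_E : M%:R * Phi + K <= T%:R * h + Phi + K.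
  have : M%:R * Phi <= (mu + 1) * Phi by rewrite ler_wpM2r // ltW.
  by rewrite /mu /h; clear; lra.
have D1E : D - 1 = d.-1%:R by rewrite /D -[d in LHS](ltn_predK d23) -natr1 addrK.
have a2 : expR (tau + Lam) = 2%:R * a by rewrite expRD tau2 lnK.
have le_Y : (44 * 2 ^ M)%:R ^+ d * (2%:R * a) ^+ (M + 10) * rho1 ^+ ((M + 10) * d.-1)
    <= expR lnY.
  have -> : lnY = d%:R * ((6 + M)%:R * tau) + (M + 10)%:R * (tau + Lam)
      + ((M + 10) * d.-1)%:R * r.
    by rewrite /lnY D1E !natrM !natrD; ring.
  rewrite 2!expRD !expRM_natl a2 tau2 lnK ?posrE //.
  rewrite !ler_wpM2r ?exprn_ge0 //.
  rewrite lerXn2r ?nnegrE ?exprn_ge0 // exprD natrM natrX ler_wpM2r ?exprn_ge0 //.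
  by rewrite -natrX ler_nat.
have TL : (d%:R + w - 1) * T%:R = 11%:R * mu by rewrite /mu; field.
split => //.
- pose b := ln (B.+1%:R : R).
  have Bb : B.+1%:R = expR b :> R by rewrite lnK // posrE.
  have blnY : (w + 1) * lnY < b by rewrite -ltr_expR -Bb.
  apply: le_lt_trans (_ : expR (T%:R * lnY + (d * T)%:R * b) < _).
    rewrite expRD !expRM_natl -Bb ler_wpM2r ?exprn_ge0 // lerXn2r ?nnegrE ?expR_ge0 //.
    by rewrite !mulr_ge0 // ?exprn_ge0.
  rewrite Bb -expRM_natl ltr_expR !natrM.
  have b0 : 0 < b.
    by apply: le_lt_trans blnY; rewrite mulr_ge0 //; clear -w0; lra.
  have h1 : (D + w - 1) * T%:R * b <= 11%:R * M%:R * b.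
    by rewrite ler_wpM2r ?(ltW b0) // TL ler_pM2l ?ltr0n.
  have w1p : 0 < (w - 1) * T%:R by rewrite mulr_gt0 //; clear -w1; lra.
  have h2 : (w - 1) * T%:R * ((w + 1) * lnY) < (w - 1) * T%:R * b by rewrite ltr_pM2l.
  have h3 : (w - 1) * T%:R * ((w + 1) * lnY) = T%:R * lnY.
    have -> : (w - 1) * T%:R * ((w + 1) * lnY) = (w ^+ 2 - 1) * (T%:R * lnY) by ring.
    by rewrite w2; ring.
  by rewrite -/D; move: h1 h2; rewrite h3; clear; lra.
- move=> i delta iT delta0 deltale.
  (* Since [11 (M - 1) <= (d + w - 1) T], about [(w - 1) T] orders are lost and [(2 - w) T]
     remain. *)
  have iR : i%:R <= (w - 1) * T%:R + 10%:R * D + 10%:R.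
    have : (i + d * (T - 10))%:R <= (11 * M.-1 + 10)%:R :> R by rewrite ler_nat.
    rewrite !natrD !natrM natrB // -/D.
    have -> : M.-1%:R = M%:R - 1 :> R by rewrite /M -natr1 addrK.
    by move: M2 TL; clear; lra.
  have le_iT : (i <= T)%N.
    by rewrite -(ler_nat R); move: iR dT; clear; lra.
  have delta_exp : delta ^+ (T - i) <= expR (- Delta * (T - i)%:R).
    have -> : - Delta * (T - i)%:R = (T - i)%:R * (- Delta) by rewrite mulrC.
    rewrite expRM_natl lerXn2r ?nnegrE ?expR_ge0 //; apply: le_trans deltale _.
    have -> : - Delta = l + (2 * d)%:R * tau - (d - 1 - d0)%:R * Lam.
      have d1 : (1 <= d)%N by apply: leq_trans d23.
      have -> : (d - 1 - d0)%:R = D - 1 - x :> R.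
        by rewrite natrB ?natrB // leq_subRL // add1n.
      by rewrite /Delta natrM; ring.
    by rewrite !expRD expRN !expRM_natl tau2 !lnK.
  rewrite mulrA.
  have Zd : Z * delta ^+ (T - i) <= expR (T%:R * h + Phi + K - Delta * (T - i)%:R).
    rewrite expRD ler_pM ?exprn_ge0 //.
    - by rewrite !mulr_ge0 ?exprn_ge0.
    - by apply: le_trans le_Z _; rewrite ler_expR.
    - by rewrite -mulNr.
  have q10 : 2%:R * q ^+ 10 = expR (tau + 10%:R * Lq).
    by rewrite expRD expRM_natl tau2 lnK.
  apply: le_trans (_ : expR (tau + 10%:R * Lq) *
      expR (T%:R * h + Phi + K - Delta * (T - i)%:R) <= _).
    by rewrite q10 ler_wpM2l ?expR_ge0.
  rewrite -expRD -[leRHS]expR0 ler_expR natrB //.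
  have : Delta * ((2%:R - w) * T%:R - 10%:R * D - 10%:R) <= Delta * (T%:R - i%:R).
    by rewrite ler_wpM2l ?(ltW Delta0) //; move: iR; clear; lra.
  by move: T1; rewrite /S0 /g; clear; lra.
have q10 : 2%:R * q ^+ 10 = expR (tau + 10%:R * Lq).
  by rewrite expRD expRM_natl tau2 lnK.
rewrite mulrA q10.
apply: le_trans (_ : expR (tau + 10%:R * Lq) * expR (T%:R * h + Phi + K) <= _).
  by rewrite ler_wpM2l ?expR_ge0 // (le_trans le_Z) // ler_expR.
rewrite /C !powR_expR // -!expRD ler_expR -/Lam -/r -/tau -/Lq.
have DeltaL : Delta <= (D - 1) * Lam.
  have : 0 <= x * Lam by rewrite mulr_ge0 // ltW.
  have : 0 <= D * tau by rewrite mulr_ge0 //; clear -D23; lra.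
  by move: l0; rewrite /Delta; clear; lra.
have := @constant_dominates R w x D eta Lam r tau kappa Delta w0 w2 x0 D23 eta0
  (ltW k10) kle (ltW Lam0) r0 tau0 (ltW Delta0) DeltaL.
rewrite /= -/Phi -/K -/h.
(* This ratio fixes the exponent: the bound on [T h] contains [10 ln q] times [h / g], which
   together with [q^10] stays below [q^kappa]. *)
have hg : h / g <= kappa / 10%:R - 1.
  by rewrite ler_pdivrMr //; move: kg; rewrite /g; clear; lra.
have S0q : 0 <= S0 + 10%:R * Lq.
  by move: S0g; rewrite pmulr_lge0 // invr_gt0.
have hT : T%:R * h <= (kappa / 10%:R - 1) * (S0 + 10%:R * Lq) + h.
  apply: le_trans T2 _; rewrite lerD2r mulrAC -mulrA mulrC ler_wpM2r //.
by move: hT; rewrite /S0; clear; lra.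
Qed.

(** * The approximation inequality *)

(** With [y = |a| - 1 - rho], the product is at least [y^n] and [|P(z)| <= L (2 y)^d0]; since
    [y > L], [y >= 2] and [n > 2 d0], the spare powers of [y] cover both [L] and [2^d0]. *)
Lemma monic_part_dominates (R : rcfType) (P : {poly R[i]}) (th : seq R[i]) (a z : R[i])
    (rho L : R) :
  0 <= rho -> 1 <= L -> \sum_(i < size P) normc P`_i = L ->
  (forall t, t \in th -> normc t <= rho) ->
  (2 * (size P).-1 < size th)%N ->
  L * 2%:R + 2%:R * rho + 2%:R <= normc a ->
  normc (z - a) <= 1 ->
  normc P.[z] < normc (\prod_(t <- th) (z - t)).
Proof.
move=> rho0 L1 PL thrho; set d0 := (size P).-1; set n := size th => dn La za.
have [d0n d0n'] : (n = d0 + (n - d0).-1.+1)%N /\ (d0 <= (n - d0).-1)%N.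
  by clear -dn; lia.
pose y := normc a - 1 - rho.
have y2 : 2%:R <= y by rewrite /y; lra.
have yL : L < y by rewrite /y; lra.
have y0 : 0 < y by lra.
have zy : normc z <= 2%:R * y.
  by have := lerB_normc z a; rewrite /y; lra.
have zt t : t \in th -> y <= normc (z - t).
  move=> /thrho trho; have := lerB_normc z t.
  by have := lerB_normc a z; rewrite normc_distC /y; lra.
apply: lt_le_trans (normc_prod_sub_ge (ltW y0) zt); rewrite -/n.
apply: le_lt_trans (_ : L * (2%:R * y) ^+ d0 < _).
  by rewrite -PL normc_horner_le //; lra.
rewrite exprMn mulrA [in ltRHS]d0n exprD mulrC ltr_pM2l ?exprn_gt0 //.
rewrite exprS; apply: lt_le_trans (_ : y * 2%:R ^+ d0 <= _).
  by rewrite ltr_pM2r ?exprn_gt0.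
rewrite ler_wpM2l ?(ltW y0) //.
apply: le_trans (_ : y ^+ d0 <= _); first by rewrite lerXn2r ?nnegrE ?(ltW y0).
by apply: ler_weXn2l => //; lra.
Qed.

(** Here [|z| <= 2 |a|] and [|z - t| >= |a| / 2]; the power of 2 collects [2^d0] from [P] and [2^n]
    from [Q], rounded up to [2^(2 d)], where [d = n + 1]. *)
Lemma near_root_dist (R : rcfType) (P : {poly R[i]}) (th : seq R[i]) (a z : R[i])
    (rho L : R) :
  0 <= rho -> 1 <= L -> \sum_(i < size P) normc P`_i = L ->
  (forall t, t \in th -> normc t <= rho) ->
  ((size P).-1 <= size th)%N ->
  L * 2%:R + 2%:R * rho + 2%:R <= normc a ->
  normc (z - a) <= 1 ->
  (z - a) * \prod_(t <- th) (z - t) + P.[z] = 0 ->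
  normc (z - a) <=
    L * 2%:R ^+ (2 * (size th).+1) / normc a ^+ (size th - (size P).-1).
Proof.
move=> rho0 L1 PL thrho; set d0 := (size P).-1; set n := size th => dn La za rz.
set A := normc a in La *.
have A4 : 4%:R <= A by lra.
have A0 : 0 < A by lra.
have zA : normc z <= 2%:R * A.
  by have := lerB_normc z a; rewrite -/A; lra.
have zt t : t \in th -> A / 2%:R <= normc (z - t).
  move=> /thrho trho; have := lerB_normc z t.
  by have := lerB_normc a z; rewrite normc_distC -/A; lra.
have A20 : 0 <= A / 2%:R by lra.
have := normc_prod_sub_ge A20 zt; rewrite -/n => Qge.
have : normc ((z - a) * \prod_(t <- th) (z - t)) <= L * (2%:R * A) ^+ d0.
  have -> : (z - a) * \prod_(t <- th) (z - t) = - P.[z].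
    by apply/eqP; rewrite -addr_eq0 rz.
  by rewrite normcN -PL normc_horner_le //; lra.
rewrite normcM => le1.
have le2 : normc (z - a) * (A / 2%:R) ^+ n <= L * (2%:R * A) ^+ d0.
  by apply: le_trans le1; rewrite ler_wpM2l ?normc_ge0.
rewrite ler_pdivlMr ?exprn_gt0 //.
have An : A ^+ n = A ^+ (n - d0) * A ^+ d0 by rewrite -exprD subnK.
have Ad : 0 < A ^+ d0 by rewrite exprn_gt0.
rewrite -(ler_pM2r Ad) -mulrA -An.
have -> : normc (z - a) * A ^+ n = normc (z - a) * (A / 2%:R) ^+ n * 2%:R ^+ n.
  by rewrite -mulrA -exprMn divfK // pnatr_eq0.
apply: le_trans (_ : L * (2%:R * A) ^+ d0 * 2%:R ^+ n <= _).
  by rewrite ler_wpM2r ?exprn_ge0.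
rewrite exprMn -!mulrA ler_wpM2l //; first lra.
rewrite mulrCA mulrC ler_wpM2r ?(ltW Ad) // -exprD ler_weXn2l ?ler1n //.
by clear -dn; lia.
Qed.

(** The last hypothesis is applied to the derivative of [A]: a multiple root anywhere would make the
    derivative vanish at xi, which is simple. *)
Lemma conjugates_uniq (R : rcfType) (A : {poly int}) (rs : seq R[i]) (xi : R[i]) :
  map_poly intr A = \prod_(z <- rs) ('X - z%:P) -> xi \in rs ->
  count_mem xi rs = 1%N ->
  (forall (v : {poly int}) g0 g, g0 \in rs -> g \in rs ->
     root (map_poly intr v) g0 -> root (map_poly intr v) g) ->
  uniq rs.
Proof.
move=> Ars xirs xi1 irr.
apply: count_mem_uniq => z; have [zrs|] := boolP (z \in rs); last by move/count_memPn.
have split_at y : y \in rs ->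
    map_poly intr A^`() = \prod_(t <- rem y rs) ('X - t%:P)
      + ('X - y%:P) * (\prod_(t <- rem y rs) ('X - t%:P))^`().
  move=> yrs; rewrite -deriv_map Ars (perm_big _ (perm_to_rem yrs)) big_cons /=.
  by rewrite derivM derivB derivX derivC subr0 mul1r.
have rootE y : y \in rs -> root (map_poly intr A^`()) y = (y \in rem y rs).
  move=> yrs; rewrite (split_at y yrs) /root hornerD hornerM hornerXsubC subrr mul0r addr0.
  by rewrite -[_ == 0]/(root _ _) root_prod_XsubC.
have memE y : y \in rs -> (y \in rem y rs) = (1 < count_mem y rs)%N.
  move=> yrs; rewrite -has_pred1 has_count (seq.permP (perm_to_rem yrs)) /= eqxx.
  by rewrite add1n ltnS.
have nxi : ~~ root (map_poly intr A^`()) xi by rewrite rootE // memE // xi1.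
have : ~~ root (map_poly intr A^`()) z by apply: contra nxi; apply: irr.
have : (0 < count_mem z rs)%N by rewrite -has_count has_pred1.
by rewrite rootE // memE //; case: (count_mem z rs) => [|[|]].
Qed.

Lemma small_poly_not_root (R : rcfType) (rs : seq R[i]) (v : {poly int}) (z : R[i]) :
  uniq rs ->
  (forall (v : {poly int}) g0 g, g0 \in rs -> g \in rs ->
     root (map_poly intr v) g0 -> root (map_poly intr v) g) ->
  v != 0 -> (size v <= size rs)%N -> z \in rs -> ~~ root (map_poly intr v) z.
Proof.
move=> urs irr v0 szv zrs; apply/negP => vz.
have vC0 : map_poly intr v != 0 :> {poly R[i]}.
  by rewrite map_poly_eq0_id0 // intr_eq0 lead_coef_eq0.
have ar : all (root (map_poly intr v)) rs.
  by apply/allP => y yrs; apply: irr zrs yrs vz.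
have := max_poly_roots vC0 ar urs.
by rewrite ltnNge (leq_trans (size_poly _ _) szv).
Qed.

(** Turns the inequalities of Siegel's lemma into equations: the product of the values is an integer
    of modulus less than 1, so one value is 0, and conjugacy carries this to all roots. *)
Lemma small_values_vanish (R : rcfType) (A v : {poly int}) (rs : seq R[i]) :
  A \is monic -> map_poly intr A = \prod_(z <- rs) ('X - z%:P) -> (0 < size rs)%N ->
  (forall (v : {poly int}) g0 g, g0 \in rs -> g \in rs ->
     root (map_poly intr v) g0 -> root (map_poly intr v) g) ->
  (forall z, z \in rs -> normc (map_poly intr v).[z] < 1) ->
  forall z, z \in rs -> root (map_poly intr v) z.
Proof.
move=> monA Ars rs0 irr vlt z zrs.
have [N e] := prod_horner_roots_int v monA Ars.
have lt1 : normc (\prod_(z <- rs) (map_poly intr v).[z]) < 1.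
  case: rs rs0 vlt {zrs irr Ars e} => // y rs _ vlt.
  rewrite normc_prod big_cons.
  apply: le_lt_trans (_ : normc (map_poly intr v).[y] * 1 < 1).
    rewrite ler_wpM2l ?normc_ge0 // big_seq; apply: prodr_ile1 => t trs.
    by rewrite normc_ge0 ltW // vlt // inE trs orbT.
  by rewrite mulr1 vlt ?mem_head.
have N0 : N = 0.
  by move: lt1; rewrite e normc_int -[1]/(1%:~R) ltr_int; lia.
have : \prod_(z <- rs) (map_poly intr v).[z] == 0 by rewrite e N0.
rewrite prodf_seq_eq0 => /hasP[y yrs /= vy].
by apply: irr vy.
Qed.

Lemma coprime_no_common_root (R : rcfType) (P Q : {poly int}) (z : R[i]) :
  coprimep P Q -> root (map_poly intr P) z -> root (map_poly intr Q) z -> False.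
Proof.
move=> /Pdiv.Idomain.Bezout_coprimepP[[u v] /= e] Pz Qz.
have [c c0 uvE] : exists2 c : int, c != 0 & u * P + v * Q = c%:P.
  by apply/size_poly1P; rewrite (Pdiv.Idomain.eqp_size e) size_poly1.
have : (map_poly (intr : int -> R[i]) (u * P + v * Q)).[z] = 0.
  by rewrite rmorphD !rmorphM /= !hornerE (rootP Pz) (rootP Qz) !mulr0 addr0.
by rewrite uvE map_polyC hornerC => /eqP; rewrite intr_eq0 (negPf c0).
Qed.

Lemma root_map_real (R : rcfType) (v : {poly int}) (x : R) :
  root (map_poly intr v) (x%:C : R[i]) = root (map_poly intr v) x.
Proof.
have -> : map_poly intr v = map_poly (real_complex R) (map_poly intr v) :> {poly R[i]}.
  by rewrite -map_poly_comp; apply: eq_map_poly => m /=; rewrite rmorph_int.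
by rewrite fmorph_root.
Qed.

(** The [i]-th divided derivative at [a] is compared on [y = p / q] and on [y = xi]: the former is
    at least [q^(-10)], the latter at most half of that by the choice of [T], so the difference, at
    most [Z |xi - p / q|], makes up the other half. *)
Lemma approximation_lower_bound (R : realType) (A : {poly int}) (rs : seq R[i])
    (xi rho1 delta Cq : R) (a p q : int) (T M B : nat) :
  let absa : R := `|a|%:~R in
  let Z := (B * 110)%:R * 8%:R ^+ M * (2%:R * absa) ^+ (M + 10) in
  A \is monic -> map_poly intr A = \prod_(z <- rs) ('X - z%:P) ->
  (forall (v : {poly int}) g0 g, g0 \in rs -> g \in rs ->
     root (map_poly intr v) g0 -> root (map_poly intr v) g) ->
  uniq rs -> (11 <= size rs)%N -> xi%:C \in rs ->
  (forall z, z \in rs -> z != xi%:C -> normc z <= rho1) -> 1 <= rho1 ->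
  6%:R <= absa -> `|xi - a%:~R| <= 1 -> `|xi - a%:~R| <= delta ->
  1 <= q -> `|xi - p%:~R / q%:~R| <= 1 ->
  ((44 * 2 ^ M)%:R ^+ size rs * (2%:R * absa) ^+ (M + 10)
     * rho1 ^+ ((M + 10) * (size rs).-1)) ^+ T
    * B.+1%:R ^+ (size rs * T) < B.+1%:R ^+ (M * 11) ->
  (forall (i : nat) (delta' : R), (i + size rs * (T - 10) <= 11 * M.-1 + 10)%N ->
     0 <= delta' -> delta' <= delta ->
     2%:R * (q%:~R ^+ 10 * (Z * delta' ^+ (T - i))) <= 1) ->
  2%:R * (q%:~R ^+ 10 * Z) <= Cq ->
  1 <= Cq * `|xi - p%:~R / q%:~R|.
Proof.
move=> absa Z monA Ars irr urs d11 xirs rsrho rho1_ge1 a6 xia xid q1 xiq P1 P2 P3.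
have absaE : absa = `|a%:~R| by rewrite /absa intr_norm.
have S1 : 1 <= 2%:R * absa by clear -a6; lra.
have rsC z : z \in rs -> conjc z \in rs.
  rewrite -!(root_prod_XsubC rs) -Ars => /rootP Az.
  by apply/rootP; rewrite horner_int_conjc Az rmorph0.
have xile : `|xi| <= absa + 1.
  rewrite absaE -lerBlDl; apply: le_trans xia; exact: lerB_dist.
have aLe : absa <= `|xi| + 1.
  rewrite absaE -lerBlDl distrC in xia *; apply: le_trans xia; exact: lerB_dist.
have betale : `|p%:~R / q%:~R| <= 2%:R * absa.
  have : `|p%:~R / q%:~R| - `|xi| <= 1.
    by apply: le_trans xiq; rewrite distrC; apply: lerB_dist.
  by move: xile a6; clear; lra.
(* This is the bound that the halving of heights on [y = p / q] requires. *)
have betage : 3%:R <= `|p%:~R / q%:~R : R|.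
  have : `|xi| - `|p%:~R / q%:~R| <= 1.
    by apply: le_trans xiq; apply: lerB_dist.
  by move: aLe a6; clear; lra.
have q0 : 0 < q by rewrite (lt_le_trans _ q1).
have q0R : 0 < q%:~R :> R by rewrite ltr0z.
have pq : 3%:Z * q <= `|p|.
  rewrite -(ler_int R) intrM intr_norm -ler_pdivlMr //.
  by rewrite normf_div (gtr0_norm q0R) in betage.
pose s (z : R[i]) : R := if z == xi%:C then 2%:R * absa else rho1.
have sP z : z \in rs -> 1 <= s z /\ normc z <= s z.
  rewrite /s; case: eqVneq => [-> _|zx zrs]; last by split=> //; apply: rsrho.
  by split=> //; rewrite normc_real; move: xile a6; clear; lra.
have prodE : \prod_(z <- rs) ((4 * 11 * 2 ^ M)%:R * s z ^+ (M + 10)) =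
    (44 * 2 ^ M)%:R ^+ size rs * (2%:R * absa) ^+ (M + 10)
     * rho1 ^+ ((M + 10) * (size rs).-1).
  rewrite big_split /= prodr_const_seq -mulrA; congr (_ * _).
  rewrite (perm_big _ (perm_to_rem xirs)) big_cons /= {1}/s eqxx; congr (_ * _).
  rewrite exprM -(size_rem xirs) -prodr_const_seq !big_seq; apply: eq_bigr => z.
  by rewrite mem_rem_uniq // inE /s => /andP[/negPf->].
have bound : (\prod_(z <- rs) ((4 * 11 * 2 ^ M)%:R * s z ^+ (M + 10))) ^+ T
    * B.+1%:R ^+ (size rs * T) < B.+1%:R ^+ (M * 11) :> R by rewrite prodE.
have [g [szg gn0 gB glt]] := siegel_aux rsC sP bound.
have rs0 : (0 < size rs)%N by apply: leq_trans d11.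
have sol : aux_solution M 11 T B rs g.
  split=> // i z iT; move: z.
  apply: (small_values_vanish monA Ars rs0 irr) => z zrs; exact: glt.
have not_root (v : {poly int}) z : v != 0 -> (size v <= 11)%N -> z \in rs ->
    ~~ root (map_poly intr v) z.
  move=> v0 szv; apply: (small_poly_not_root urs irr v0).
  exact: leq_trans szv d11.
have rsq z : z \in rs -> q%:~R * z != p%:~R.
  move=> zrs; have := not_root (q *: 'X - p%:P) z.
  have sz2 : size (q *: 'X - p%:P) = 2%N.
    rewrite size_polyDl ?size_scale ?size_polyX ?lt0r_neq0 // size_polyN.
    by rewrite (leq_ltn_trans (size_polyC_leq1 _)).
  rewrite -size_poly_gt0 sz2 => /(_ isT isT zrs); apply: contra => /eqP e.
  by rewrite /root rmorphB /= map_polyZ map_polyX map_polyC /= !hornerE e subrr.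
have [g' sol' atn0] := aux_solution_nonzero q1 pq rsq sol.
have [szg' _ gB' vg'] := sol'.
set beta : R := p%:~R / q%:~R in xiq betale betage *.
have atR : aux_at M g' beta != 0.
  have -> : beta = ratr (p%:~R / q%:~R) by rewrite fmorph_div !rmorph_int.
  by rewrite -map_aux_at map_poly_eq0.
have atC : aux_at M g' (beta%:C : R[i]) != 0.
  by rewrite -(map_aux_at (real_complex R)) map_poly_eq0.
have ars : (a%:~R : R) %:C \notin rs.
  apply/negP => ars; have := not_root ('X - a%:P) _ _ _ ars.
  rewrite polyXsubC_eq0 size_XsubC root_map_real => /(_ isT isT) /negP; apply.
  by rewrite /root rmorphB /= map_polyX map_polyC /= !hornerE subrr.
have [i ile Di] := aux_nonvanishing sol' urs ars (fun v v0 szv z zrs =>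
   not_root v z v0 szv zrs) atC.
have DR : (aux_at M g' beta)^`N(i).[a%:~R] != 0.
  move: Di; rewrite -(map_aux_at (real_complex R)) nderivn_map horner_map /=.
  by apply: contraNneq => ->.
have lower := aux_eval_lower szg' q1 DR.
have S2 : `|xi| <= 2%:R * absa by move: xile a6; clear; lra.
have aS : `|a%:~R : R| <= 2%:R * absa by rewrite -absaE; move: a6; clear; lra.
have dist := @aux_eval_dist R M 10 i B g' beta xi a%:~R _ szg' gB' S1 betale S2 aS.
have vR m : (m < T)%N -> root (map_poly intr (aux_diag M m g')) xi.
  by move=> mT; rewrite -root_map_real; apply: vg'.
have diag := @aux_eval_diag_le R M 10 i B T g' xi a%:~R _ szg' gB' vR S1 S2.
rewrite (distrC a%:~R) in diag; have {}diag := diag xia.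
set D := _.[_] in lower dist; set D' := _.[_] in dist diag.
have Z0 : 0 <= Z by rewrite !mulr_ge0 ?exprn_ge0 // (le_trans _ S1).
have leZ : (B * (11 * 10))%:R * 2%:R ^+ M * (2%:R * absa) ^+ (M + 10) <= Z.
  rewrite /Z -[(11 * 10)%N]/110%N !ler_wpM2r ?exprn_ge0 ?(le_trans _ S1) //.
  by rewrite ler_wpM2l // lerXn2r ?nnegrE // ler_nat.
have leZ' : (B * 11)%:R * 8%:R ^+ M * (2%:R * absa) ^+ (M + 10) <= Z.
  rewrite /Z !ler_wpM2r ?exprn_ge0 ?(le_trans _ S1) // ler_nat.
  by rewrite leq_mul2l orbT.
have up := P2 i `|xi - a%:~R| ile (normr_ge0 _) xid.
have qn : 0 <= q%:~R ^+ 10 :> R by rewrite exprn_ge0 // ltW.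
have dist' : `|D - D'| <= Z * `|xi - beta|.
  by apply: le_trans dist _; rewrite distrC ler_wpM2r.
have diag' : `|D'| <= Z * `|xi - a%:~R| ^+ (T - i).
  by apply: le_trans diag _; rewrite ler_wpM2r ?exprn_ge0.
have tri : `|D| <= `|D - D'| + `|D'| by rewrite -{1}(subrK D' D) ler_normD.
have h1 : q%:~R ^+ 10 * `|D| <=
    q%:~R ^+ 10 * (Z * `|xi - beta|) + q%:~R ^+ 10 * (Z * `|xi - a%:~R| ^+ (T - i)).
  rewrite -mulrDr ler_wpM2l //; apply: le_trans tri _; exact: lerD.
have h2 : 2%:R * (q%:~R ^+ 10 * (Z * `|xi - beta|)) <= Cq * `|xi - beta|.
  have -> : 2%:R * (q%:~R ^+ 10 * (Z * `|xi - beta|)) =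
    2%:R * (q%:~R ^+ 10 * Z) * `|xi - beta| by rewrite -!mulrA.
  by rewrite ler_wpM2r.
by move: lower h1 h2 up; clear; lra.
Qed.

Local Close Scope complex_scope.

(** * Existence of the real zero, and assembly of the estimates *)

Lemma poly_length_normc (R : rcfType) (P : {poly int}) :
  \sum_(i < size (map_poly intr P : {poly R[i]})) normc (map_poly intr P : {poly R[i]})`_i =
  (poly_length P)%:~R.
Proof.
rewrite size_map_inj_poly //; last exact: intr_inj.
rewrite /poly_length rmorph_sum; apply: eq_bigr => i _.
by rewrite coef_map normc_int.
Qed.

Lemma poly_length_ge1 (P : {poly int}) : P != 0 -> 1 <= poly_length P.
Proof.
move=> P0; have sP : (0 < size P)%N by rewrite size_poly_gt0.
have lt_sP : ((size P).-1 < size P)%N by rewrite prednK.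
rewrite /poly_length (bigD1 (Ordinal lt_sP)) //= -[leLHS]addr0 lerD ?sumr_ge0 //.
by rewrite -gtz0_ge1 normr_gt0 -/(lead_coef P) lead_coef_eq0.
Qed.

Lemma normc_int_near (R : rcfType) (x : R) (a : int) :
  normc ((x%:C)%C - a%:~R) = `|x - a%:~R|.
Proof. by rewrite -(rmorph_int (real_complex R)) -rmorphB normc_real. Qed.

(* [P / Q] is small near [a], so [A] takes values of opposite signs at [a - 1]
   and [a + 1]. *)
Lemma near_root_exists (R : rcfType) (P Q : {poly R}) (a : R) :
  (forall x, `|x - a| <= 1 -> `|P.[x]| < `|Q.[x]|) ->
  exists2 xi, root (('X - a%:P) * Q + P) xi & `|xi - a| < 1.
Proof.
move=> PQ; set A := _ * Q + P.
have le_a : a - 1 <= a + 1 by lra.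
have n1 : `|a - 1 - a| <= 1 by rewrite ler_norml; apply/andP; split; lra.
have n2 : `|a + 1 - a| <= 1 by rewrite ler_norml; apply/andP; split; lra.
have Q0 x : a - 1 <= x <= a + 1 -> Q.[x] != 0.
  move=> /andP[x1 x2]; rewrite -normr_gt0; apply: le_lt_trans (PQ x _) => //.
  by rewrite ler_norml; apply/andP; split; lra.
have A1 : A.[a - 1] = P.[a - 1] - Q.[a - 1] by rewrite !hornerE; ring.
have A2 : A.[a + 1] = P.[a + 1] + Q.[a + 1] by rewrite !hornerE; ring.
have := PQ _ n1; have := PQ _ n2; rewrite !ltr_norml => PQ2 PQ1.
have same : 0 < Q.[a - 1] * Q.[a + 1].
  rewrite ltNge; apply/negP => QQ.
  have [x xin /rootP Qx] := polyrcf.poly_ivt le_a QQ.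
  by have := Q0 x; rewrite Qx eqxx; rewrite itv_boundlr in xin; move=> /(_ xin).
have opp : A.[a - 1] * A.[a + 1] < 0.
  rewrite A1 A2; case/andP: PQ1 PQ2 => p1 p1' /andP[p2 p2'].
  have [q1|q1] := ltP 0 Q.[a - 1].
    have q2 : 0 < Q.[a + 1] by rewrite (pmulr_rgt0 _ q1) in same.
    rewrite gtr0_norm // in p1 p1'; rewrite gtr0_norm // in p2 p2'.
    by rewrite nmulr_rlt0; lra.
  have {}q1 : Q.[a - 1] < 0.
    rewrite lt_neqAle q1 andbT; apply: contraTneq same => ->.
    by rewrite mul0r ltxx.
  have q2 : Q.[a + 1] < 0 by rewrite (nmulr_rgt0 _ q1) in same.
  rewrite ltr0_norm // in p1 p1'; rewrite ltr0_norm // in p2 p2'.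
  by rewrite pmulr_rlt0; lra.
have [x xin Ax] := polyrcf.poly_ivtoo le_a opp.
exists x => //; rewrite ltr_norml; move: xin; rewrite in_itv /= => /andP[x1 x2].
by apply/andP; split; lra.
Qed.

Lemma horner_int_real (R : rcfType) (v : {poly int}) (x : R) :
  (map_poly intr v).[(x%:C)%C] = ((map_poly intr v).[x]%:C)%C.
Proof.
rewrite -[RHS](horner_map (real_complex R)) -map_poly_comp; congr (_.[_]).
by apply: eq_map_poly => m /=; rewrite rmorph_int.
Qed.

Lemma powR_ge_of_log (R : realType) (x y E : R) :
  1 <= x -> x `^ E + 1 <= y -> E * ln x <= ln y.
Proof.
move=> x1 xy; have x0 : 0 < x by apply: lt_le_trans x1.
have e0 : 0 < x `^ E by apply: powR_gt0.
rewrite -ln_powR ler_ln ?posrE //; first by lra.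
by lra.
Qed.

Theorem theorem4p2 (R : realType) (d0 d : nat) (P Q : {poly int}) (a : int)
    (eta : R) :
  let rho : R := max_root_modulus R Q in
  let L : R := (poly_length P)%:~R in
  let absa : R := `|a|%:~R in
  let A : {poly int} := ('X - a%:P) * Q + P in
  let dhat : R := 213%:R / 100%:R * d0%:R + 23%:R in
  let f (u : R) : R :=
    (3%:R - 2%:R * Num.sqrt 2%:R) *
      ((u - d0%:R - 1) / (u + Num.sqrt 2%:R - 1)) in
  let kappahat : R := 10%:R * (1 + 1 / (11%:R * f d%:R - 1)) in
  let kappa : R := kappahat + eta in
  let a0 : R :=
    (2%:R ^+ (2 * d) * (rho + 1) ^+ d * L ^+ 2)
      `^ (kappa / (eta * (11%:R * f dhat - 1))) + 1 in
  let C : R :=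
    2%:R `^ (42%:R * (d0%:R + eta + 1) * d%:R ^+ 2)
    * (rho + 1) `^ (5%:R * (d0%:R + eta + 1) * d%:R ^+ 2)
    * absa `^ (14%:R * (d0%:R + eta + 1) * d%:R ^+ 2) in
  coprimep P Q ->
  size P = d0.+1 ->
  size Q = d -> (1 < d)%N -> Q \is monic ->
  dhat <= d%:R ->
  L * Num.max 2%:R ((rho + 1) ^+ d0) + 2%:R * rho + 2%:R <= absa ->
  0 < eta ->
  [/\ exists! xi : R,
        root (map_poly intr A) xi /\ `|xi - a%:~R| < 1,
      kappahat <= 10%:R * (1 + 1 / (11%:R * f dhat - 1)) < dhat &
      forall xi : R,
        root (map_poly intr A) xi -> `|xi - a%:~R| < 1 ->
        a0 <= absa ->
        strict_type_le xi kappa /\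
        forall p q : int, 1 <= q ->
          1 / (C * q%:~R `^ kappa) <= `|xi - p%:~R / q%:~R| ].
Proof.
move=> rho L absa A dhat f kappahat kappa a0 C cop sP sQ d1 monQ dh ahyp eta0.
pose w : R := Num.sqrt 2%:R.
have w0 : 0 < w by rewrite sqrtr_gt0.
have w2 : w ^+ 2 = 2%:R by rewrite sqr_sqrtr.
have x0 : 0 <= d0%:R :> R by apply: ler0n.
have fE u : f u = gain_ratio w d0%:R u by [].
have F0 : 0 < 11%:R * f dhat - 1 by apply: gain_ratio_dhat_gt.
have Fd : f dhat <= f d%:R by apply: gain_ratio_mono.
have khat_le : kappahat <= 10%:R * (1 + 1 / (11%:R * f dhat - 1)).
  exact: exponent_le_dhat.
have khat_lt : 10%:R * (1 + 1 / (11%:R * f dhat - 1)) < dhat.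
  exact: exponent_lt_dhat.
have dn : (213 * d0 + 23 * 100 <= 100 * d)%N.
  rewrite -(ler_nat R) natrD !natrM; move: dh; rewrite /dhat; clear; lra.
have [th Qth] := monic_split_closed R[i] monQ.
have sth : size th = d.-1.
  have := congr1 (fun p : {poly R[i]} => size p) Qth.
  by rewrite size_map_inj_poly ?sQ; [rewrite size_prod_XsubC => -> | exact: intr_inj | ].
have sQ1 : (1 < size Q)%N by rewrite sQ.
have [[z0 _ z0rho] rhomax] := max_root_modulusP R sQ1.
have rho0 : 0 <= rho by rewrite /rho -z0rho normc_ge0.
have thrho t : t \in th -> normc t <= rho.
  by move=> tth; apply: rhomax; rewrite Qth root_prod_XsubC.
have P0 : P != 0 by rewrite -size_poly_gt0 sP.
have L1 : 1 <= L by rewrite /L ler1z poly_length_ge1.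
pose PC : {poly R[i]} := map_poly intr P.
have sPC : (size PC).-1 = d0.
  by rewrite size_map_inj_poly ?sP //; exact: intr_inj.
have PL : \sum_(i < size PC) normc PC`_i = L by apply: poly_length_normc.
pose aC : R[i] := a%:~R.
have aCE : normc aC = absa by rewrite normc_int.
have La : L * 2%:R + 2%:R * rho + 2%:R <= normc aC.
  rewrite aCE; apply: le_trans ahyp; rewrite !lerD2r ler_wpM2l ?(le_trans _ L1) //.
  by rewrite le_max lexx.
have La' : L * (rho + 1) ^+ (size PC).-1 + 2%:R * rho + 2%:R <= normc aC.
  rewrite aCE sPC; apply: le_trans ahyp; rewrite !lerD2r ler_wpM2l ?(le_trans _ L1) //.
  by rewrite le_max lexx orbT.
have AE (z : R[i]) : (map_poly intr A).[z] = (z - aC) * \prod_(t <- th) (z - t) + PC.[z].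
  rewrite rmorphD rmorphM rmorphB /= map_polyX map_polyC Qth /= hornerD hornerM.
  rewrite hornerXsubC horner_prod; congr (_ * _ + _).
  by apply: eq_bigr => t _; rewrite hornerXsubC.
have d2 : (2 * (size PC).-1 < size th)%N by rewrite sPC sth; clear -dn; lia.
have near_normc (x : R) : normc ((x%:C)%C - aC) = `|x - a%:~R|.
  exact: normc_int_near.
have AC (x : R) : root (map_poly intr A) x ->
    ((x%:C)%C - aC) * \prod_(t <- th) ((x%:C)%C - t) + PC.[(x%:C)%C] = 0.
  by move=> /rootP Ax; rewrite -AE horner_int_real Ax.
have near_uniq (z z' : R[i]) : normc (z - aC) < 1 -> normc (z' - aC) < 1 ->
    root (map_poly intr A) z -> root (map_poly intr A) z' -> z = z'.
  move=> za z'a /rootP Az /rootP Az'; rewrite AE in Az; rewrite AE in Az'.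
  apply: (near_root_unique rho0 L1 PL thrho _ La za z'a Az Az').
  by rewrite sPC sth; clear -dn d1; lia.
have [xi0 Axi0 xi0a] : exists2 xi : R, root (map_poly intr A) xi & `|xi - a%:~R| < 1.
  have AR : map_poly intr A = ('X - (a%:~R)%:P) * map_poly intr Q + map_poly intr P :> {poly R}.
    by rewrite rmorphD rmorphM rmorphB /= map_polyX map_polyC.
  rewrite AR; apply: near_root_exists => x xa.
  have := monic_part_dominates rho0 L1 PL thrho d2 La (_ : normc ((x%:C)%C - aC) <= 1).
  rewrite near_normc => /(_ xa).
  have <- : (map_poly intr Q).[(x%:C)%C] = \prod_(t <- th) ((x%:C)%C - t) :> R[i].
    by rewrite Qth horner_prod; apply: eq_bigr => t _; rewrite hornerXsubC.
  by rewrite !horner_int_real !normc_real.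
split.
- exists xi0; split=> // y [Ay ya]; apply/complexI/near_uniq; rewrite ?near_normc //.
    by rewrite root_map_real.
  by rewrite root_map_real.
- by apply/andP.
move=> xi Axi xia a0a.
have r1 : 1 <= rho + 1 by clear -rho0; lra.
have r0 : 0 < rho + 1 by apply: lt_le_trans r1.
have L0 : 0 < L by apply: lt_le_trans L1.
pose X : R := 2%:R ^+ (2 * d) * (rho + 1) ^+ d * L ^+ 2.
have lnX : ln X = 2%:R * d%:R * ln 2%:R + d%:R * ln (rho + 1) + 2%:R * ln L.
  have lnn (y : R) n : 0 < y -> ln (y ^+ n) = n%:R * ln y.
    by move=> y0; rewrite lnXn // mulr_natl.
  rewrite /X !lnM ?posrE ?mulr_gt0 ?exprn_gt0 // !lnn //.
  rewrite natrM; congr (_ + _); clear; lra.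
have Xge : 4%:R ^+ d * (rho + 1) <= X.
  have e4 : 2%:R ^+ 2 = 4%:R :> R by ring.
  rewrite /X exprM e4 -mulrA ler_wpM2l ?exprn_ge0 //.
  rewrite -[leLHS]mulr1 ler_pM ?(ltW r0) ?exprn_ege1 //.
  by rewrite -[leLHS]expr1 ler_weXn2l // ltnW.
have X1 : 1 <= X.
  apply: le_trans Xge; rewrite -[leLHS]mulr1 ler_pM //.
  by rewrite exprn_ege1 // ler1n.
have khat0 : 10%:R < kappahat.
  have : 0 < 1 / (11%:R * f d%:R - 1).
    by rewrite divr_gt0 //; move: F0 Fd; clear; lra.
  by rewrite /kappahat; clear; lra.
have kappa0 : 0 < kappa by rewrite /kappa; move: khat0 eta0; clear; lra.
have etaF : 0 < eta * (11%:R * f dhat - 1) by rewrite mulr_gt0.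
have logX := powR_ge_of_log X1 a0a.
(* As [11 f(dhat) - 1 <= 1] and [kappa > eta], the exponent in [a0] is at least 1; so
   [|a| >= X + 1], which already exceeds [2 d (rho + 1) + 2] and makes xi a simple root. *)
have E1 : 1 <= kappa / (eta * (11%:R * f dhat - 1)).
  rewrite ler_pdivlMr // mul1r.
  have f2 : 11%:R * f dhat - 1 <= 1.
    have /andP[w1 w1'] := sqrt2_bounds w0 w2.
    have : (3%:R - 2%:R * w) * ((dhat - d0%:R - 1) / (dhat + w - 1)) <= (3%:R - 2%:R * w) * 1.
      rewrite ler_wpM2l //; first by clear -w1'; lra.
      rewrite ler_pdivrMr; last by rewrite /dhat; move: x0 w1; clear; lra.
      by move: x0 w1; clear; lra.
    by rewrite -/(f dhat); move: w1; clear; lra.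
  have : eta * (11%:R * f dhat - 1) <= eta * 1 by rewrite ler_wpM2l // ltW.
  by rewrite /kappa; move: khat0; clear; lra.
have Xa : X + 1 <= absa.
  apply: le_trans a0a; rewrite lerD2r -{1}(powRr1 (le_trans ler01 X1)).
  by rewrite ler_powR.
have d4 : (2 * d + 2 <= 4 ^ d)%N.
  have e : (d.+1 <= 2 ^ d)%N by apply: ltn_expl.
  have e2 : (2 <= 2 ^ d)%N by apply: leq_trans e; rewrite ltnS ltnW.
  rewrite -[4%N]/(2 * 2)%N expnMn.
  have := leq_mul e2 e; clear; lia.
have abig : 2%:R * d%:R * (rho + 1) + 2%:R < absa.
  have e : (2 * d + 2)%:R * (rho + 1) <= 4%:R ^+ d * (rho + 1).
    by rewrite ler_pM2r // -natrX ler_nat.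
  rewrite natrD natrM in e.
  by move: e Xge Xa r1; clear; lra.
have a6 : 6%:R <= absa.
  have : 2%:R * 2%:R * 1 <= 2%:R * d%:R * (rho + 1).
    by rewrite !ler_pM ?mulr_ge0 // ?ler_nat.
  by move: abig; clear; lra.
have a1 : 1 < absa by move: a6; clear; lra.
(* Logarithmic form of [|a| >= a0], passed from [dhat] to [d] by monotonicity of [f]. *)
have H1 : kappa * (2%:R * d%:R * ln 2%:R + d%:R * ln (rho + 1) + 2%:R * ln L) <=
    eta * (11%:R * f d%:R - 1) * ln absa.
  rewrite -lnX; apply: le_trans (_ : eta * (11%:R * f dhat - 1) * ln absa <= _).
    by rewrite -ler_pdivrMl // mulrA [X in X * _ <= _]mulrC.
  rewrite ler_wpM2r ?ln_ge0 ?(ltW a1) // ler_wpM2l ?(ltW eta0) //.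
  by move: Fd; clear; lra.
have szXQ : size (('X - a%:P) * Q) = d.+1.
  by rewrite size_Mmonic ?polyXsubC_eq0 // size_XsubC sQ.
have szPQ : (size P < size (('X - a%:P) * Q)%R)%N.
  by rewrite szXQ sP ltnS; clear -dn; lia.
have monA : A \is monic.
  by rewrite monicE lead_coefDl // -monicE monicMl ?monicXsubC.
have [rs Ars] := monic_split_closed R[i] monA.
have srs : size rs = d.
  have := congr1 (fun p : {poly R[i]} => size p) Ars.
  rewrite size_map_inj_poly //; last exact: intr_inj.
  by rewrite size_prod_XsubC size_polyDl // szXQ => -[].
have rsA z : (z \in rs) = root (map_poly intr A) z by rewrite Ars root_prod_XsubC.
have xirs : (xi%:C)%C \in rs by rewrite rsA root_map_real.
have rsxi z : z \in rs -> normc z <= rho + 1 \/ z = (xi%:C)%C.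
  rewrite rsA => Az; have := rootP Az; rewrite AE => Az'.
  have [|za] := root_dichotomy rho0 L1 PL thrho d2 La La' Az'; first by left.
  by right; apply: near_uniq; rewrite ?near_normc ?root_map_real.
have xi1 : count_mem (xi%:C)%C rs = 1%N.
  have rsE : \prod_(z <- rs) ('X - z%:P) =
      ('X - aC%:P) * \prod_(t <- th) ('X - t%:P) + PC.
    by rewrite -Ars -Qth rmorphD rmorphM rmorphB /= map_polyX map_polyC.
  have [] // := sum_roots_near rsE _ rho0 thrho rsxi xirs.
  - by rewrite size_map_inj_poly ?sP ?sth //; [clear -dn; lia | exact: intr_inj].
  - by rewrite near_normc.
  by rewrite aCE srs.
(* Away from xi, [|z - a| > L (rho + 1)^d0 >= |P(z)| = |z - a| |Q(z)|]; a zero of [Q] here would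
   also be one of [P]. *)
have Qsmall z : z \in rs -> z != (xi%:C)%C -> 0 < normc (map_poly intr Q).[z] < 1.
  move=> zrs zxi; have [zle|/eqP] := rsxi z zrs; last by rewrite (negPf zxi).
  have QE : (map_poly intr Q).[z] = \prod_(t <- th) (z - t).
    by rewrite Qth horner_prod; apply: eq_bigr => t _; rewrite hornerXsubC.
  have Az : (z - aC) * (map_poly intr Q).[z] = - PC.[z].
    apply/eqP; rewrite -addr_eq0 QE -AE; move: zrs; rewrite rsA => /rootP ->.
    exact: eqxx.
  have := congr1 (@normc R) Az; rewrite normcM normcN => nA.
  have Ple : normc PC.[z] <= L * (rho + 1) ^+ (size PC).-1.
    by rewrite -PL normc_horner_le.
  have zale : L * (rho + 1) ^+ (size PC).-1 < normc (z - aC).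
    have := lerB_normc aC z; rewrite normc_distC; move: La' zle rho0.
    move: (normc (z - aC)) (normc z) (normc aC) (L * _) => ? ? ? ?; clear; lra.
  have za0 : 0 < normc (z - aC).
    by apply: le_lt_trans zale; rewrite mulr_ge0 ?(ltW L0) ?exprn_ge0 ?(ltW r0).
  apply/andP; split.
    rewrite lt_neqAle normc_ge0 andbT eq_sym normc_eq0; apply/negP => Qz.
    have Pz : PC.[z] = 0.
      by apply/eqP; rewrite -oppr_eq0 -Az (eqP Qz) mulr0.
    by apply: (coprime_no_common_root cop (z := z)) => //; apply/rootP.
  rewrite -(ltr_pM2l za0) mulr1 nA.
  by apply: le_lt_trans Ple zale.
have irr (v : {poly int}) g0 g : g0 \in rs -> g \in rs ->
    root (map_poly intr v) g0 -> root (map_poly intr v) g.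
  exact: (conjugate_roots monA Ars xi1 Qsmall).
have urs : uniq rs by apply: conjugates_uniq Ars xirs xi1 irr.
have C1 : 1 <= C.
  have pow1 (y e : R) : 1 <= y -> 0 <= e -> 1 <= y `^ e.
    by move=> y1 e0; rewrite -[leLHS](powRr0 y) ler_powR.
  have e0 (k : R) : 0 <= k -> 0 <= k * (d0%:R + eta + 1) * d%:R ^+ 2.
    by move=> k0; rewrite !mulr_ge0 ?exprn_ge0 // !addr_ge0 // ltW.
  rewrite /C; apply: mulr_ege1; [apply: mulr_ege1|]; apply: pow1;
    rewrite ?(ltW a1) ?e0 ?ler0n ?ler1n //.
have C0 : 0 < C by apply: lt_le_trans C1.
suff main p q : 1 <= q -> 1 / (C * q%:~R `^ kappa) <= `|xi - p%:~R / q%:~R|.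
  split=> //; split; last by exists C.
  exists (map_poly intr A); first by
    rewrite map_poly_eq0_id0 ?monic_neq0 // ?(monicP monA) ?oner_neq0.
  have -> : map_poly (@ratr R) (map_poly intr A) = map_poly intr A.
    by rewrite -map_poly_comp; apply: eq_map_poly => m /=; rewrite ratr_int.
  exact: Axi.
move=> q1; have q1R : 1 <= q%:~R :> R by rewrite ler1z.
have qk1 : 1 <= q%:~R `^ kappa.
  by rewrite -[leLHS](powRr0 (q%:~R : R)) ler_powR // ltW.
have Cq0 : 0 < C * q%:~R `^ kappa by rewrite mulr_gt0 // (lt_le_trans _ qk1).
rewrite ler_pdivrMr // mulrC.
(* Beyond distance 1 the bound is trivial, [C] and [q^kappa] being at least 1. *)
have [far|near] := ltP 1 `|xi - p%:~R / q%:~R|.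
  by rewrite mulr_ege1 ?(ltW far) // mulr_ege1.
have d23 : (23 <= d)%N by clear -dn; lia.
have d0d : (d0 < d)%N by clear -dn; lia.
have F0d : 0 < 11%:R * gain_ratio w d0%:R d%:R - 1.
  by move: F0 Fd; rewrite !fE; clear; lra.
have kle : kappa <= 213%:R / 100%:R * d0%:R + 23%:R + eta.
  by rewrite /kappa lerD2r; apply: le_trans khat_le (ltW khat_lt).
have [T [M [B /= [P1 P2 P3]]]] := thue_parameters w0 w2 d23 d0d F0d a1 r1 L1 q1R eta0
  (erefl : kappa = 10%:R * (1 + 1 / (11%:R * gain_ratio w d0%:R d%:R - 1)) + eta) kle H1.
have dist := near_root_dist rho0 L1 PL thrho _ La _ (AC _ Axi).
rewrite near_normc sPC sth aCE prednK ?(ltnW d1) // in dist.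
have {}dist : `|xi - a%:~R| <= L * 2%:R ^+ (2 * d) / absa ^+ (d - 1 - d0).
  rewrite subn1; apply: dist; last exact: ltW.
  by clear -dn; lia.
apply: (@approximation_lower_bound R A rs xi (rho + 1) _ _ a p q T M B monA Ars irr urs
  _ xirs _ r1 a6 (ltW xia) dist q1 near); rewrite ?srs //.
- by clear -d23; lia.
- by move=> z zrs zxi; have [//|/eqP] := rsxi z zrs; rewrite (negPf zxi).
Qed.
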